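(* For $x=(x_1,x_2,x_3)\in\mathbb{C}^3$ the following are equivalent: (1) $x_1=\bar x_2x_3$, $|x_3|=1$ and $|x_2|\le1$; (2) either $x_1x_2\ne x_3$ and $\Psi(\cdot,x)$ is an automorphism of $\mathbb{D}$, or $x_1x_2=x_3$ and $|x_1|=|x_2|=|x_3|=1$; (3) $x$ is a peak point of $\overline{\mathbb{E}}$; (4) there exists a $2\times2$ unitary matrix $U$ such that $x=\pi(U)$; (5) there exists a symmetric $2\times2$ unitary matrix $U$ such that $x=\pi(U)$; (6) $x$ belongs to the distinguished boundary $b\mathbb{E}$ of $\mathbb{E}$; (7) $x\in\overline{\mathbb{E}}$ and $|x_3|=1$.
   Context: $\mathbb{D}$ is the open unit disc. The tetrablock is $\mathbb{E}=\{x\in\mathbb{C}^3: 1-x_1z-x_2w+x_3zw\ne0 \text{ whenever } |z|\le1,\ |w|\le1\}$, with closure $\overline{\mathbb{E}}$. For $x\in\mathbb{C}^3$ with $x_1x_2\neq x_3$, $\Psi(z,x)=\dfrac{x_3z-x_1}{x_2z-1}$. For $A=[a_{ij}]\in\mathbb{C}^{2\times2}$, $\pi(A)=(a_{11},a_{22},\det A)$. $A(\mathbb{E})$ is the algebra of continuous complex-valued functions on $\overline{\mathbb{E}}$ that are holomorphic on $\mathbb{E}$. A point $p\in\overline{\mathbb{E}}$ is a peak point of $\overline{\mathbb{E}}$ if there is $g\in A(\mathbb{E})$ with $g(p)=1$ and $|g(y)|<1$ for all $y\in\overline{\mathbb{E}}\setminus\{p\}$. A boundary for $\mathbb{E}$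 is a subset $C$ of $\overline{\mathbb{E}}$ such that every function in $A(\mathbb{E})$ attains its maximum modulus (over $\overline{\mathbb{E}}$) on $C$; the distinguished boundary $b\mathbb{E}$ is the smallest closed boundary, i.e. the closed boundary contained in every closed boundary (it exists by the theory of uniform algebras). ''Symmetric'' means $U^T=U$. *)

(* Defs.v *)
From HB Require Import structures.
From mathcomp Require Import all_boot all_order all_algebra.
From mathcomp Require Import complex.
From mathcomp Require Import all_classical all_reals all_analysis.

Set Implicit Arguments.
Unset Strict Implicit.
Unset Printing Implicit Defensive.

Import Order.TTheory GRing.Theory Num.Theory.
Import numFieldNormedType.Exports.

Local Open Scope classical_set_scope.
Local Open Scope ring_scope.

(* R[i] itself carries no topology; seen as a numClosedFieldType it receives
   the canonical one, and [differentiable] below is then C-differentiability.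
   The norm takes values in C, where a < b and a <= b force b - a to be real. *)
Definition C (R : realType) : numClosedFieldType := R[i].

Definition C3 (R : realType) : normedModType (C R) := (C R * C R * C R)%type.

Definition holomorphic_on (R : realType) (V : normedModType (C R))
  (A : set V) (f : V -> C R) : Prop := forall x, A x -> differentiable f x.

Definition disc (R : realType) : set (C R) := [set z | `|z| < 1].

Definition disc_automorphism (R : realType) (f : C R -> C R) : Prop :=
  holomorphic_on (@disc R) f /\
  exists g : C R -> C R,
    [/\ holomorphic_on (@disc R) g,
        forall z, disc z -> disc (f z) /\ g (f z) = z &
        forall z, disc z -> disc (g z) /\ f (g z) = z].

Definition tetrablock (R : realType) : set (C3 R) :=
  [set x | forall z w : C R, `|z| <= 1 -> `|w| <= 1 ->
     1 - x.1.1 * z - x.1.2 * w + x.2 * z * w != 0].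

(* At a pole (x2 * z = 1) division returns 0.  When x1 * x2 != x3 the function
   is unbounded near such a point, so it is not even continuous there: a
   function with a pole in the disc never satisfies [disc_automorphism]. *)
Definition Psi (R : realType) (z : C R) (x : C3 R) : C R :=
  (x.2 * z - x.1.1) / (x.1.2 * z - 1).

Definition tetra_pi (R : realType) (A : 'M[C R]_2) : C3 R :=
  (A 0 0, A 1 1, \det A).

(* Functions are total on C^3: only the values on the closure matter. *)
Definition tetra_algebra (R : realType) : set (C3 R -> C R) :=
  [set f | {within closure (@tetrablock R), continuous f} /\
           holomorphic_on (@tetrablock R) f].

Definition peak_point (R : realType) (p : C3 R) : Prop :=
  closure (@tetrablock R) p /\
  exists g : C3 R -> C R,
    [/\ tetra_algebra g, g p = 1 &
        forall y, closure (@tetrablock R) y -> y <> p -> `|g y| < 1].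

Definition boundary_for_tetrablock (R : realType) (B : set (C3 R)) : Prop :=
  B `<=` closure (@tetrablock R) /\
  forall f, tetra_algebra f ->
    exists2 p, B p & forall y, closure (@tetrablock R) y -> `|f y| <= `|f p|.

Definition smallest_closed_boundary (R : realType) (B : set (C3 R)) : Prop :=
  [/\ closed B, boundary_for_tetrablock B &
      forall B', closed B' -> boundary_for_tetrablock B' -> B `<=` B'].

(* There is at most one B with [smallest_closed_boundary B]; the set below is
   that B (and would be empty if there were none). *)
Definition distinguished_boundary (R : realType) : set (C3 R) :=
  [set p | exists2 B, smallest_closed_boundary B & B p].

(* Main.v *)
(** Every condition describes the set S of points with |x3| = 1, |x2| <= 1 and
    x1 = x2' x3, where ' is conjugation.  On the closed tetrablock one has
      |x1 - x2' x3| + |x2 - x1' x3| <= 1 - |x3|^2,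
    which forces x into S when |x3| = 1, and which places any x with |x3| < 1 at
    z = x3 on the affine disc z |-> (b1 + b2' z, b2 + b1' z, z), where
    |b1| + |b2| <= 1.  Such a disc lies in the closed tetrablock and its boundary
    circle lies in S, so by the maximum principle S is a boundary.  Each point
    (b' c, b, c) of S is a peak point of the polynomial
      ((1 + c' x3) / 2)^2 (1 - (x2 - b) (c' x1 - b') / 4),
    so S lies in every boundary.

    The maximum principle is derived from the mean value property on concentric
    circles.  As f is only assumed differentiable at each point, the latter comes
    from Goursat's bisection argument, applied to f(z)/z on a polar grid.  No
    integral is needed: the bisection works on trapezoidal sums, which vanish
    exactly on affine functions, and over a regular polygon the trapezoidal sum of
    f(z)/z is a multiple of the sum of the values of f at the vertices. *)

Require Import Defs.
From mathcomp Require Import all_boot all_order all_algebra.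
From mathcomp Require Import complex ring lra.
From mathcomp Require Import all_classical all_reals all_analysis.

Set Implicit Arguments.
Unset Strict Implicit.
Unset Printing Implicit Defensive.

Import Order.TTheory GRing.Theory Num.Theory.
Import numFieldNormedType.Exports.

Local Open Scope classical_set_scope.
Local Open Scope ring_scope.

Local Notation "x %:C" := (real_complex _ x) (format "x %:C") : ring_scope.

(** * Goursat's lemma for trapezoidal sums *)

Section Chords.
Variables (R : realType) (g : C R -> C R).

(** Twice the trapezoidal approximation of the integral of [g] along the polygon with vertices p 0,
    ..., p n. *)
Definition chord_sum (p : nat -> C R) n : C R :=
  \sum_(i < n) (g (p i) + g (p i.+1)) * (p i.+1 - p i).

Lemma chord_sumD p m n :
  chord_sum p (m + n) = chord_sum p m + chord_sum (fun i => p (m + i)%N) n.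
Proof.
rewrite /chord_sum big_split_ord /=; congr (_ + _).
by apply: eq_bigr => i _; rewrite addnS.
Qed.

(* The subtracted term is the integral of 2 (a + b z), which telescopes and so
   cancels along a closed polygon. *)
Lemma chord_sum_le p n (a b k e : C R) :
  (forall i, (i <= n)%N -> `|g (p i) - (a + b * p i)| <= k) ->
  (forall i, (i < n)%N -> `|p i.+1 - p i| <= e) ->
  `|chord_sum p n - (2 * a * (p n - p 0%N) + b * (p n ^+ 2 - p 0%N ^+ 2))|
    <= n%:R * (2 * k * e).
Proof.
move=> gk pe.
have -> : chord_sum p n - (2 * a * (p n - p 0%N) + b * (p n ^+ 2 - p 0%N ^+ 2))
   = \sum_(i < n) ((g (p i) - (a + b * p i)) + (g (p i.+1) - (a + b * p i.+1)))
        * (p i.+1 - p i).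
  rewrite /chord_sum; elim: n {gk pe} => [|n IHn].
    by rewrite !big_ord0; ring.
  rewrite !big_ord_recr /= -IHn; ring.
apply: le_trans (ler_norm_sum _ _ _) _.
rewrite -[n in n%:R]card_ord mulr_natl -sumr_const; apply: ler_sum => i _.
rewrite normrM; apply: ler_pM => //; last exact: pe.
apply: le_trans (ler_normD _ _) _; rewrite mulr2n mulrDl mul1r.
by apply: lerD; apply: gk => //; apply: ltnW.
Qed.

Variable P : R -> R -> C R.

(* The side of the parameter square from (s, t) is n d, cut into n steps. *)
Definition boundary_sum s t d n : C R :=
  chord_sum (fun i => P (s + i%:R * d) t) n
  + chord_sum (fun i => P (s + n%:R * d) (t + i%:R * d)) n
  - chord_sum (fun i => P (s + i%:R * d) (t + n%:R * d)) n
  - chord_sum (fun i => P s (t + i%:R * d)) n.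

(** With the mesh [d] fixed, a square of twice the side splits into four; each inner side is run
    through twice in opposite directions and cancels. *)
Lemma boundary_sum_double s t d n :
  boundary_sum s t d (n + n) =
    boundary_sum s t d n + boundary_sum (s + n%:R * d) t d n
    + boundary_sum s (t + n%:R * d) d n
    + boundary_sum (s + n%:R * d) (t + n%:R * d) d n.
Proof.
have E (x : R) m : x + (n + m)%:R * d = x + n%:R * d + m%:R * d.
  by rewrite natrD mulrDl addrA.
have Es u v : (fun i => P (u + (n + i)%:R * d) v)
    = (fun i => P (u + n%:R * d + i%:R * d) v) by apply/funext => i; rewrite E.
have Et u v : (fun i => P u (v + (n + i)%:R * d))
    = (fun i => P u (v + n%:R * d + i%:R * d)) by apply/funext => i; rewrite E.
rewrite /boundary_sum !chord_sumD !Es !Et !E.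
by ring.
Qed.

End Chords.

(** The differential is C-linear, hence multiplication by its value at 1; the estimate is the
    little-o form of differentiability. *)
Lemma differentiable_affine (R : realType) (g : C R -> C R) (a : C R) :
  differentiable g a ->
  exists b, forall e : C R, 0 < e -> exists2 d : C R, 0 < d &
    forall z, `|z - a| < d -> `|g z - (g a + b * (z - a))| <= e * `|z - a|.
Proof.
move=> dg; exists ('d g a 1) => e e0.
have /diff_locally/eqaddoP H := dg; have /nbhs_normP[/= d d0 {}H] := H e e0.
exists d => // z za.
have := H (z - a); rewrite /= sub0r normrN => /(_ za).
rewrite !fctE /= subrK.
suff -> : 'd g a (z - a) = 'd g a 1 * (z - a) by [].
by rewrite mulrC -[RHS]/((z - a) *: 'd g a 1) -linearZ; congr ('d g a _);
  rewrite /= [RHS]mulr1.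
Qed.

(** The signs are those of the four sides of a square; the y's stand for the telescoped affine
    terms, which cancel around the loop. *)
Lemma norm_add4_le (K : numDomainType) (x1 x2 x3 x4 y1 y2 y3 y4 e1 e2 e3 e4 : K) :
  `|x1 - y1| <= e1 -> `|x2 - y2| <= e2 -> `|x3 - y3| <= e3 ->
  `|x4 - y4| <= e4 -> y1 + y2 - y3 - y4 = 0 ->
  `|x1 + x2 - x3 - x4| <= e1 + e2 + e3 + e4.
Proof.
move=> H1 H2 H3 H4 y0.
rewrite (_ : x1 + _ - _ - _ = (x1 - y1) + (x2 - y2) - (x3 - y3) - (x4 - y4)).
  apply: le_trans (ler_normB _ _) (lerD _ H4).
  apply: le_trans (ler_normB _ _) (lerD _ H3).
  exact: le_trans (ler_normD _ _) (lerD H1 H2).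
by rewrite -[LHS]subr0 -y0; ring.
Qed.

(** By [chord_sum_le], with chords of length at most L d, each of the four sides deviates from its
    affine term by at most n (2 k L d). *)
Lemma boundary_sum_le (R : realType) (g : C R -> C R) (P : R -> R -> C R)
    s t d n (a b k L : C R) : 0 <= d ->
  (forall u v, s <= u <= s + n%:R * d -> t <= v <= t + n%:R * d ->
    `|g (P u v) - (a + b * P u v)| <= k) ->
  (forall u u' v, s <= u <= s + n%:R * d -> s <= u' <= s + n%:R * d ->
    t <= v <= t + n%:R * d -> `|P u v - P u' v| <= L * `|u - u'|%:C) ->
  (forall u v v', s <= u <= s + n%:R * d -> t <= v <= t + n%:R * d ->
    t <= v' <= t + n%:R * d -> `|P u v - P u v'| <= L * `|v - v'|%:C) ->
  `|boundary_sum g P s t d n| <= 8 * k * L * (n%:R * d)%:C.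
Proof.
move=> d0 Hk HLs HLt.
have nd0 : 0 <= n%:R * d by rewrite mulr_ge0.
have dist x i : `|x + i.+1%:R * d - (x + i%:R * d)| = d.
  by rewrite (_ : _ - _ = d) ?ger0_norm// mulrSr; ring.
have int x i : (i <= n)%N -> x <= x + i%:R * d <= x + n%:R * d.
  by move=> ni; rewrite lerDl mulr_ge0//= lerD2l ler_wpM2r// ler_nat.
have int0 x : x <= x <= x + n%:R * d by rewrite lexx lerDl.
have int1 x : x <= x + n%:R * d <= x + n%:R * d by rewrite lexx lerDl nd0.
have Ls v i : t <= v <= t + n%:R * d -> (i < n)%N ->
    `|P (s + i.+1%:R * d) v - P (s + i%:R * d) v| <= L * d%:C.
  by move=> tv ni; rewrite -[in d%:C](dist s i); apply: HLs => //;
    apply: int => //; apply: ltnW.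
have Lt u i : s <= u <= s + n%:R * d -> (i < n)%N ->
    `|P u (t + i.+1%:R * d) - P u (t + i%:R * d)| <= L * d%:C.
  by move=> tv ni; rewrite -[in d%:C](dist t i); apply: HLt => //;
    apply: int => //; apply: ltnW.
have H1 := chord_sum_le (n := n) (p := fun i => P (s + i%:R * d) t)
  (fun i ni => Hk _ _ (int s i ni) (int0 t)) (fun i => Ls _ i (int0 t)).
have H2 := chord_sum_le (n := n) (p := fun i => P (s + n%:R * d) (t + i%:R * d))
  (fun i ni => Hk _ _ (int1 s) (int t i ni)) (fun i => Lt _ i (int1 s)).
have H3 := chord_sum_le (n := n) (p := fun i => P (s + i%:R * d) (t + n%:R * d))
  (fun i ni => Hk _ _ (int s i ni) (int1 t)) (fun i => Ls _ i (int1 t)).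
have H4 := chord_sum_le (n := n) (p := fun i => P s (t + i%:R * d))
  (fun i ni => Hk _ _ (int0 s) (int t i ni)) (fun i => Lt _ i (int0 s)).
have -> : 8 * k * L * (n%:R * d)%:C = n%:R * (2 * k * (L * d%:C))
   + n%:R * (2 * k * (L * d%:C)) + n%:R * (2 * k * (L * d%:C))
   + n%:R * (2 * k * (L * d%:C)).
  by rewrite rmorphM /= rmorph_nat; ring.
apply: norm_add4_le H1 H2 H3 H4 _.
by rewrite mul0r !addr0; ring.
Qed.

Lemma half_exprS (R : realFieldType) k : 2^-1 ^+ k.+1 + 2^-1 ^+ k.+1 = 2^-1 ^+ k :> R.
Proof. by rewrite exprS; field. Qed.

(** Left endpoints increase and right endpoints s k + 2^-k decrease, so the supremum of the left
    endpoints lies in every interval. *)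
Lemma nested_dyadic (R : realType) (s : nat -> R) :
  (forall k, s k <= s k.+1 <= s k + 2^-1 ^+ k.+1) ->
  exists x, forall k, s k <= x <= s k + 2^-1 ^+ k.
Proof.
move=> Hs.
have h0 k : 0 <= 2^-1 ^+ k :> R by rewrite exprn_ge0// invr_ge0.
have up : {homo s : m n / (m <= n)%N >-> m <= n}.
  by apply: homo_leq => [//|? ? ?|k]; [exact: le_trans|have /andP[] := Hs k].
have dn : {homo (fun k => s k + 2^-1 ^+ k) : m n / (m <= n)%N >-> n <= m}.
  apply: homo_leq => [//|x y z|k]; first by move=> /[swap]; exact: le_trans.
  by rewrite -[in leRHS]half_exprS addrA lerD2r; have /andP[] := Hs k.
have H j k : s j <= s k + 2^-1 ^+ k.
  have [jk|kj] := leqP j k; first by apply: le_trans (up _ _ jk) _; rewrite lerDl.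
  by apply: le_trans (dn _ _ (ltnW kj)); rewrite lerDl.
exists (sup (range s)) => k; apply/andP; split.
  by apply: sup_upper_bound; [|by exists k]; split;
    [exists (s 0%N); exists 0%N|exists (s 0%N + 2^-1 ^+ 0) => _ [j _ <-]].
by apply: ge_sup; [exists (s 0%N); exists 0%N|move=> _ [j _ <-]].
Qed.

Lemma half_expr_lt (R : realType) (e : R) : 0 < e -> exists k, 2^-1 ^+ k < e.
Proof.
move=> e0; have /cvgrPdist_lt/(_ _ e0)[k _ /(_ k (leqnn k))] :
    (fun k => 2^-1 ^+ k : R) @ \oo --> 0.
  by apply: cvg_expr; rewrite ger0_norm ?invr_ge0// invf_lt1// ltr1n.
by rewrite sub0r normrN ger0_norm ?exprn_ge0 ?invr_ge0//; exists k.
Qed.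

(** * Bisection of the parameter square *)

Section Goursat.
Variables (R : realType) (g : C R -> C R) (P : R -> R -> C R) (L : C R).
Hypothesis L0 : 0 < L.
Hypothesis dg : forall s t : R, 0 <= s <= 1 -> 0 <= t <= 1 -> differentiable g (P s t).
Hypothesis HLs : forall u u' v : R, 0 <= u <= 1 -> 0 <= u' <= 1 -> 0 <= v <= 1 ->
  `|P u v - P u' v| <= L * `|u - u'|%:C.
Hypothesis HLt : forall u v v' : R, 0 <= u <= 1 -> 0 <= v <= 1 -> 0 <= v' <= 1 ->
  `|P u v - P u v'| <= L * `|v - v'|%:C.

(** Mesh 2^-(k + n) with 2^n steps gives a square of side 2^-k. The bound is [e] times its area, so
    the bounds for four quarters add up to the bound for the whole. *)
Let negligible (e : C R) k s t := exists N, forall n, (N <= n)%N ->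
  `|boundary_sum g P s t (2^-1 ^+ (k + n)) (2 ^ n)%N| <= e * (2^-1 ^+ k ^+ 2)%:C.

Let side k n : (2 ^ n)%:R * 2^-1 ^+ (k + n) = 2^-1 ^+ k :> R.
Proof. by rewrite exprD natrX mulrCA -exprMn divff ?expr1n ?mulr1. Qed.

Let step e k s t : ~ negligible e k s t -> exists p : R * R,
  [/\ s <= p.1 <= s + 2^-1 ^+ k.+1, t <= p.2 <= t + 2^-1 ^+ k.+1 &
      ~ negligible e k.+1 p.1 p.2].
Proof.
move=> bad; apply: contrapT => no; apply: bad.
have h0 : 0 <= 2^-1 ^+ k.+1 :> R by rewrite exprn_ge0// invr_ge0.
have good s' t' : s <= s' <= s + 2^-1 ^+ k.+1 -> t <= t' <= t + 2^-1 ^+ k.+1 ->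
    negligible e k.+1 s' t'.
  by move=> Hs Ht; apply: contrapT => b; apply: no; exists (s', t').
have i0 (x : R) : x <= x <= x + 2^-1 ^+ k.+1 by rewrite lexx lerDl.
have i1 (x : R) : x <= x + 2^-1 ^+ k.+1 <= x + 2^-1 ^+ k.+1 by rewrite lexx lerDl h0.
have [N1 H1] := good s t (i0 s) (i0 t).
have [N2 H2] := good _ t (i1 s) (i0 t).
have [N3 H3] := good s _ (i0 s) (i1 t).
have [N4 H4] := good _ _ (i1 s) (i1 t).
(* The successor is due to the halving: 2^(n+1) steps on a side of the square are 2^n steps on a
   side of each quarter. *)
exists (maxn (maxn N1 N2) (maxn N3 N4)).+1 => -[//|n].
rewrite ltnS !geq_max => /andP[/andP[n1 n2] /andP[n3 n4]].
rewrite expnS mul2n -addnn boundary_sum_double addnS -addSn side.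
have -> : e * (2^-1 ^+ k ^+ 2)%:C = e * (2^-1 ^+ k.+1 ^+ 2)%:C
  + e * (2^-1 ^+ k.+1 ^+ 2)%:C + e * (2^-1 ^+ k.+1 ^+ 2)%:C + e * (2^-1 ^+ k.+1 ^+ 2)%:C.
  by rewrite -!mulrDr -!rmorphD /= -(half_exprS R k); congr (_ * _%:C); ring.
apply: le_trans (ler_normD _ _) (lerD _ (H4 _ n4)).
apply: le_trans (ler_normD _ _) (lerD _ (H3 _ n3)).
exact: le_trans (ler_normD _ _) (lerD (H1 _ n1) (H2 _ n2)).
Qed.

(** If the unit square were not negligible, bisection would give nested non-negligible squares
    shrinking to a point (s, t). Near P s t the function [g] is affine up to a small relative error,
    which makes a small enough square negligible. *)
Lemma goursat (e : C R) : 0 < e -> exists N, forall n, (N <= n)%N ->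
  `|boundary_sum g P 0 0 (2^-1 ^+ n) (2 ^ n)%N| <= e.
Proof.
move=> e0; suff [N HN] : negligible e 0 0 0.
  by exists N => n /HN; rewrite expr0 expr1n rmorph1 mulr1.
apply: contrapT => bad.
(* The choice of a bad quarter is made total by the dummy value 0 on negligible squares, which the
   sequence below never meets. *)
have /choice[f Hf] (q : nat * (R * R)) : exists p : R * R,
    ~ negligible e q.1 q.2.1 q.2.2 ->
    [/\ q.2.1 <= p.1 <= q.2.1 + 2^-1 ^+ q.1.+1,
        q.2.2 <= p.2 <= q.2.2 + 2^-1 ^+ q.1.+1 &
      ~ negligible e q.1.+1 p.1 p.2].
  have [/step[p Hp]|nb] := pselect (~ negligible e q.1 q.2.1 q.2.2); first by exists p.
  by exists 0.
pose p := nat_rect (fun=> (R * R)%type) (0, 0) (fun k q => f (k, q)).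
have badp k : ~ negligible e k (p k).1 (p k).2.
  by elim: k => [//|k /(Hf (k, p k))[]].
have p1 k : (p k).1 <= (p k.+1).1 <= (p k).1 + 2^-1 ^+ k.+1.
  by have [] := Hf (k, p k) (badp k).
have p2 k : (p k).2 <= (p k.+1).2 <= (p k).2 + 2^-1 ^+ k.+1.
  by have [] := Hf (k, p k) (badp k).
have int (s : nat -> R) : s 0%N = 0 -> (forall k, s k <= s k.+1 <= s k + 2^-1 ^+ k.+1) ->
    forall k, 0 <= s k /\ s k + 2^-1 ^+ k <= 1.
  move=> s0 Hs; elim=> [|k [IH1 IH2]]; first by rewrite s0 expr0 add0r.
  have /andP[H1 H2] := Hs k; split; first exact: le_trans H1.
  by apply: le_trans IH2; rewrite -[in leRHS]half_exprS addrA lerD2r.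
have [s Hs] := nested_dyadic p1; have [t Ht] := nested_dyadic p2.
have I1 := int _ erefl p1; have I2 := int _ erefl p2.
have in1 k x : (p k).1 <= x <= (p k).1 + 2^-1 ^+ k -> 0 <= x <= 1.
  by have [a b] := I1 k => /andP[/(le_trans a)-> /le_trans]; apply.
have in2 k x : (p k).2 <= x <= (p k).2 + 2^-1 ^+ k -> 0 <= x <= 1.
  by have [a b] := I2 k => /andP[/(le_trans a)-> /le_trans]; apply.
have s01 := in1 _ _ (Hs 0%N); have t01 := in2 _ _ (Ht 0%N).
have [b Hb] := differentiable_affine (dg s01 t01).
(* With error eta (2 L h) on a square of side h, [boundary_sum_le] yields 16 L^2 eta h^2 = e h^2. *)
pose eta := e / (16 * L ^+ 2).
have eta0 : 0 < eta by rewrite divr_gt0// mulr_gt0// exprn_gt0.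
have [d d0 Hd] := Hb _ eta0.
(* Positive elements of [C R] are real, so the choice of [k] can be made in [R]. *)
have dR : d = (complex.Re d)%:C by rewrite RRe_real// gtr0_real.
have LR : L = (complex.Re L)%:C by rewrite RRe_real// gtr0_real.
have L0' : 0 < complex.Re L by rewrite -ltcR -LR.
have d0' : 0 < complex.Re d by rewrite -ltcR -dR.
(* The image of the k-th square stays within 2 L 2^-k of P s t; this must fall below [d]. *)
have [k Hk] : exists k, 2^-1 ^+ k < complex.Re d / (2 * complex.Re L).
  by apply: half_expr_lt; rewrite divr_gt0// mulr_gt0.
have h0 n : 0 <= 2^-1 ^+ n :> R by rewrite exprn_ge0// invr_ge0.
have Pk u v : (p k).1 <= u <= (p k).1 + 2^-1 ^+ k -> (p k).2 <= v <= (p k).2 + 2^-1 ^+ k ->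
    `|P u v - P s t| <= 2 * L * (2^-1 ^+ k)%:C.
  move=> Hu Hv; have u01 := in1 _ _ Hu; have v01 := in2 _ _ Hv.
  apply: le_trans (ler_distD (P s v) _ _) _.
  rewrite -mulrA [leRHS]mulr_natl mulr2n; apply: lerD.
    apply: le_trans (HLs u01 s01 v01) _; rewrite ler_pM2l// lecR ler_norml.
    by move: Hu (Hs k); lra.
  apply: le_trans (HLt s01 v01 t01) _; rewrite ler_pM2l// lecR ler_norml.
  by move: Hv (Ht k); lra.
have Pkd : 2 * L * (2^-1 ^+ k)%:C < d.
  rewrite dR LR -(rmorph_nat (real_complex R)) -!rmorphM /= ltcR.
  by move: Hk; rewrite ltr_pdivlMr ?mulr_gt0// mulrC.
(* The estimate holds for every number of steps, so the threshold is 0. *)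
apply: (badp k); exists 0%N => n _.
have := @boundary_sum_le R g P (p k).1 (p k).2 (2^-1 ^+ (k + n)) (2 ^ n)%N
  (g (P s t) - b * P s t) b (eta * (2 * L * (2^-1 ^+ k)%:C)) L (h0 _).
rewrite side => /(_ _ _ _)/le_trans; apply.
- move=> u v /Pk Hu /Hu Huv; have := Hd _ (le_lt_trans Huv Pkd).
  rewrite (_ : g (P s t) + b * _ = g (P s t) - b * P s t + b * P u v); last by ring.
  by move=> /le_trans; apply; rewrite ler_pM2l.
- by move=> u u' v /in1 Hu /in1 Hu' /in2 Hv; exact: HLs.
- by move=> u v v' /in1 Hu /in2 Hv /in2 Hv'; exact: HLt.
rewrite [(_ ^+ 2)%:C](rmorphXn (real_complex R)) /= /eta.
move: (_%:C : C R) => H.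
rewrite le_eqVlt; apply/orP; left; apply/eqP.

field; rewrite gt_eqF//.
Qed.

End Goursat.

Lemma lipschitz1_derive (R : realType) (f df : R -> R) :
  (forall x : R, is_derive x 1 f (df x)) -> (forall x, `|df x| <= 1) ->
  forall x y, `|f x - f y| <= `|x - y|.
Proof.
move=> fd df1; suff H x y : x <= y -> `|f x - f y| <= `|x - y|.
  move=> x y; have [/H//|/ltW/H] := leP x y.
  by rewrite distrC [leRHS]distrC.
move=> xy; have [|c _ fc] := MVT_segment xy (fun z _ => fd z).
  by apply: derivable_within_continuous => z _; exact: ex_derive.
by rewrite distrC fc normrM distrC ler_piMl.
Qed.

(** * The maximum principle on the disc *)

Section Cis.
Variable R : realType.

(** The period is normalised to 1 to fit the unit parameter square. *)
Definition cis (t : R) : C R := Complex (cos (2 * pi * t)) (sin (2 * pi * t)).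

Lemma cisD s t : cis (s + t) = cis s * cis t.
Proof.
apply/eqP; rewrite eq_complex /= mulrDr cosD sinD eqxx /=.
by apply/eqP; ring.
Qed.

Lemma cis0 : cis 0 = 1.
Proof. by apply/eqP; rewrite eq_complex /= mulr0 cos0 sin0 !eqxx. Qed.

Lemma cis_half : cis 2^-1 = -1.
Proof.
have -> : cis 2^-1 = Complex (cos pi) (sin pi) by rewrite /cis mulrC mulKf.
by apply/eqP; rewrite eq_complex /= cospi sinpi oppr0 !eqxx.
Qed.

Lemma cis1 : cis 1 = 1.
Proof. by rewrite (splitr 1) cisD mul1r cis_half mulrNN mulr1. Qed.

Lemma cisX t n : cis (n%:R * t) = cis t ^+ n.
Proof.
elim: n => [|n IHn]; first by rewrite mul0r cis0.
by rewrite exprS -IHn -cisD mulrSr mulrDl mul1r addrC.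
Qed.

Lemma norm_cis t : `|cis t| = 1.
Proof. by rewrite normc_def /= cos2Dsin2 sqrtr1. Qed.

Lemma cis_neq0 t : cis t != 0.
Proof. by rewrite -normr_gt0 norm_cis. Qed.

(** The real and the imaginary part contribute 2 pi each. *)
Lemma cis_lipschitz s t : `|cis s - cis t| <= (4 * pi * `|s - t|)%:C.
Proof.
have sE (x : R) : is_derive x 1 (@cos R) (- sin x) by exact: is_derive_cos.
have cE (x : R) : is_derive x 1 (@sin R) (cos x) by exact: is_derive_sin.
have sm (x : R) : `|- sin x| <= 1 by rewrite normrN sin_max.
have H1 := lipschitz1_derive sE sm (2 * pi * s) (2 * pi * t).
have H2 := lipschitz1_derive cE (@cos_max R) (2 * pi * s) (2 * pi * t).
rewrite (_ : cis s - cis t =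
  (cos (2 * pi * s) - cos (2 * pi * t))%:C + 'i * (sin (2 * pi * s) - sin (2 * pi * t))%:C).
  apply: le_trans (ler_normD _ _) _.
  rewrite normrM normCi mul1r !normc_def /= expr0n /= !addr0 !sqrtr_sqr -rmorphD lecR.
  apply: le_trans (lerD H1 H2) _.
  rewrite -mulrBr normrM (@ger0_norm _ (2 * pi)) ?mulr_ge0 ?pi_ge0//.
  by rewrite le_eqVlt -mulrDl; apply/orP; left; apply/eqP; congr (_ * _); ring.
by rewrite -complexiE; apply/eqP; rewrite eq_complex /=; simpc.
Qed.

(** The square u of the root satisfies u^(2^n) = -1, and 2 = |u^(2^n) - 1| <= 2^n |u - 1| by the
    geometric sum. This is what allows division by the factor w - 1/w of [chord_sum_circle]. *)
Lemma cis_root_gap n : 8 <= (2 ^ n.+2)%:R * `|cis (2^-1 ^+ n.+2) ^+ 2 - 1|.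
Proof.
pose u := cis (2^-1 ^+ n.+1).
have -> : cis (2^-1 ^+ n.+2) ^+ 2 = u by rewrite expr2 -cisD half_exprS.
have <- : 4 * `|u ^+ (2 ^ n) - 1| = 8.
  rewrite -cisX (_ : (2 ^ n)%:R * _ = 2^-1).
    by rewrite cis_half -opprD normrN -[1 + 1]/(2%:R) normr_nat -natrM.
  by rewrite exprS mulrCA natrX -exprMn divff ?expr1n ?mulr1.
rewrite !expnS mulnA natrM -mulrA ler_pM2l//.
rewrite subrX1 normrM mulrC ler_wpM2r//.
apply: le_trans (ler_norm_sum _ _ _) _.
under eq_bigr do rewrite normrX norm_cis expr1n.
by rewrite sumr_const card_ord.
Qed.

(** The chord from z to w z contributes (w - 1) h(z) + (1 - 1/w) h(w z); as the polygon closes,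
    shifting the index merges the two sums. *)
Lemma chord_sum_circle (h : C R -> C R) (r w : C R) n : r != 0 -> w != 0 ->
  w ^+ n = 1 ->
  chord_sum (fun z => h z / z) (fun i => r * w ^+ i) n =
    (w - w^-1) * \sum_(i < n) h (r * w ^+ i).
Proof.
move=> r0 w0 wn.
have -> : chord_sum (fun z => h z / z) (fun i => r * w ^+ i) n =
    \sum_(i < n) ((w - 1) * h (r * w ^+ i) + (1 - w^-1) * h (r * w ^+ i.+1)).
  apply: eq_bigr => i _.
  have wi0 : w ^+ i != 0 by rewrite expf_neq0.
  rewrite !exprS; field.
  by rewrite r0 w0 wi0.
rewrite big_split /= -!mulr_sumr.
suff -> : \sum_(i < n) h (r * w ^+ i.+1) = \sum_(i < n) h (r * w ^+ i) by ring.
case: n wn => [|n] wn; first by rewrite !big_ord0.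
by rewrite big_ord_recr big_ord_recl /= wn expr0 addrC.
Qed.

End Cis.

Lemma ltr0c (R : realType) (x : R) : (0 < x%:C) = (0 < x).
Proof. by rewrite -ltcR rmorph0. Qed.

(** * Comparison of the means over concentric circles *)

Section MaximumPrinciple.
Variables (R : realType) (h : C R -> C R) (M : C R).
Hypothesis dh : forall z, `|z| <= 1 -> differentiable h z.
Hypothesis hM : forall z, `|z| = 1 -> `|h z| <= M.

(** Polar coordinates on the annulus r <= |z| <= 1: [s] runs along the radius, [t] around the
    circle. *)
Let P (r s t : R) : C R := (r + s * (1 - r))%:C * cis t.

Let normP r s t : 0 < r -> r < 1 -> 0 <= s <= 1 ->
  `|P r s t| = (r + s * (1 - r))%:C /\ 0 < r + s * (1 - r) <= 1.
Proof.
move=> r0 r1 s01; have H : 0 < r + s * (1 - r) <= 1 by nra.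
rewrite normrM norm_cis mulr1 ger0_norm// ler0c.
by move: H; lra.
Qed.

(** Goursat's lemma is applied to h(z)/z on the annulus. The radial sides cancel, and the two
    circles leave w - 1/w times the difference of the sums. *)
Let circle_sums (e : C R) r : 0 < e -> 0 < r -> r < 1 -> exists n,
  `|\sum_(i < 2 ^ n) h (cis (2^-1 ^+ n) ^+ i)
    - \sum_(i < 2 ^ n) h (r%:C * cis (2^-1 ^+ n) ^+ i)| <= (2 ^ n)%:R * e.
Proof.
move=> e0 r0 r1.
have dist s s' : (s%:C - s'%:C : C R) = (s - s')%:C by rewrite rmorphB.
have pi1 : 1 <= 4 * pi :> R by have := pi_ge2 R; lra.
have pi0 : 0 < 4 * pi :> R by apply: lt_le_trans pi1.
(* The target 8 e anticipates the constant 8 of [cis_root_gap]. *)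
have [N HN] : exists N, forall n, (N <= n)%N ->
    `|boundary_sum (fun z => h z / z) (P r) 0 0 (2^-1 ^+ n) (2 ^ n)%N| <= 8 * e.
  apply: (@goursat R _ (P r) (4 * pi)%:C).
  - by rewrite ltr0c.
  - move=> s t s01 _; have [nP /andP[p0 p1]] := normP t r0 r1 s01.
    apply: differentiableM; first by apply: dh; rewrite nP -(rmorph1 (real_complex R)) lecR.
    apply: differentiableV => //.
    by rewrite -normr_gt0 nP ltr0c.
  - move=> u u' v _ _ _; rewrite -mulrBl normrM norm_cis mulr1 dist -rmorphM /=.
    rewrite normc_def /= expr0n /= addr0 sqrtr_sqr lecR.
    rewrite [X in `|X|](_ : _ = (u - u') * (1 - r)); last by ring.
    rewrite normrM mulrC ler_wpM2r//.
    by rewrite ger0_norm; lra.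
  - move=> u v v' u01 _ _; rewrite -mulrBr normrM.
    have -> : `|(r + u * (1 - r))%:C : C R| = `|P r u 0| by rewrite normrM norm_cis mulr1.
    have [-> /andP[p0 p1]] := normP 0 r0 r1 u01.
    have := cis_lipschitz v v'; rewrite rmorphM /=; apply: le_trans.
    by rewrite ler_piMl// -(rmorph1 (real_complex R)) lecR.
  - by rewrite mulr_gt0.
pose n := N.+2; exists n.
set d := 2^-1 ^+ n : R; set w := cis d.
have nd : (2 ^ n)%:R * d = 1 by rewrite natrX -exprMn divff ?expr1n.
have wn : w ^+ (2 ^ n) = 1 by rewrite -cisX nd cis1.
have w0 : w != 0 by exact: cis_neq0.
have := HN n (leq_trans (leqnSn _) (leqnSn _)).
rewrite /boundary_sum nd.
have -> : (fun i : nat => P r (0 + 1) (0 + i%:R * d)) = (fun i => 1 * w ^+ i).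
  apply/funext => i; rewrite /P !add0r cisX; congr (_ * _).
  by rewrite mul1r addrC subrK rmorph1.
have -> : (fun i : nat => P r 0 (0 + i%:R * d)) = (fun i => r%:C * w ^+ i).
  by apply/funext => i; rewrite /P add0r cisX mul0r addr0.
(* As cis 1 = cis 0, the sides t = 0 and t = 1 are the same segment. *)
have -> : (fun i : nat => P r (0 + i%:R * d) (0 + 1)) = (fun i : nat => P r (0 + i%:R * d) 0).
  by apply/funext => i; rewrite /P !add0r cis1 cis0.
rewrite [X in `|X - _|]addrAC subrr add0r.
rewrite !chord_sum_circle ?oner_neq0//; last by rewrite gt_eqF// ltr0c.
rewrite -mulrBr normrM.
have -> : \sum_(i < 2 ^ n) h (1 * w ^+ i) = \sum_(i < 2 ^ n) h (w ^+ i).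
  by apply: eq_bigr => i _; rewrite mul1r.
move: (_ - \sum_(i < _) h _) => S HS.
have gap := cis_root_gap R N.
have w2 : `|w ^+ 2 - 1| = `|w - w^-1|.
  have -> : w ^+ 2 - 1 = w * (w - w^-1) by field.
  by rewrite normrM norm_cis mul1r.
rewrite w2 in gap.
rewrite -(@ler_pM2l _ 8)//.
apply: le_trans (ler_wpM2r (normr_ge0 S) gap) _.
rewrite -mulrA [leRHS]mulrCA; exact: ler_wpM2l.
Qed.

(** The mean of [h] over roots of unity is at most [M] in modulus, the mean over a small circle is
    close to h 0, and [circle_sums] compares the two. *)
Lemma norm_center_le : `|h 0| <= M.
Proof.
have M0 : 0 <= M by apply: le_trans (hM (normr1 _)).
rewrite real_leNgt ?ger0_real//; apply/negP => lt.
(* The errors between the circles and at the centre total 2 e, short of |h 0| - M = 3 e. *)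
pose e := (`|h 0| - M) / 3.
have e0 : 0 < e by rewrite divr_gt0// subr_gt0.
have /differentiable_continuous/cvgrPdist_lt/(_ e e0) : differentiable h 0.
  by apply: dh; rewrite normr0.
move=> /nbhs_normP[/= d d0 Hd].
have dR : d = (complex.Re d)%:C by rewrite RRe_real// gtr0_real.
have d0' : 0 < complex.Re d by rewrite -ltcR -dR.
pose r := Num.min (2^-1) (complex.Re d / 2).
have r0 : 0 < r by rewrite lt_min divr_gt0// invr_gt0 ltr0n.
have r1 : r < 1 by rewrite gt_min invf_lt1// ltr1n.
have rd : r < complex.Re d by rewrite gt_min [X in _ || X]gtr_pMr// invf_lt1// ltr1n orbT.
have [n Hn] := circle_sums e0 r0 r1.
set w := cis (2^-1 ^+ n) in Hn.
have N0 : 0 < (2 ^ n)%:R :> C R by rewrite ltr0n expn_gt0.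
suff : (2 ^ n)%:R * `|h 0| <= (2 ^ n)%:R * (M + e + e).
  rewrite ler_pM2l// -subr_ge0 => /(lt_le_trans _)-/(_ (- e)).
  rewrite oppr_lt0 => /(_ e0).
  suff -> : M + e + e - `|h 0| = - e by rewrite ltxx.
  by rewrite /e; field.
have H0 : `|(2 ^ n)%:R * h 0 - \sum_(i < 2 ^ n) h (r%:C * w ^+ i)| <= (2 ^ n)%:R * e.
  rewrite mulr_natl -[X in _ *+ X]card_ord -sumr_const -sumrB.
  apply: le_trans (ler_norm_sum _ _ _) _.
  rewrite mulr_natl -[X in _ *+ X]card_ord -sumr_const; apply: ler_sum => i _.
  apply/ltW/Hd; rewrite /= sub0r normrN normrM normrX norm_cis expr1n mulr1 dR.
  by rewrite ger0_norm ?ler0c ?ltcR// ltW.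
have H1 : `|\sum_(i < 2 ^ n) h (w ^+ i)| <= (2 ^ n)%:R * M.
  apply: le_trans (ler_norm_sum _ _ _) _.
  rewrite mulr_natl -[X in _ *+ X]card_ord -sumr_const; apply: ler_sum => i _.
  by apply: hM; rewrite normrX norm_cis expr1n.
rewrite -[X in X * _ <= _](ger0_norm (ltW N0)) -normrM !mulrDr.
rewrite -[X in `|X|](subrK (\sum_(i < 2 ^ n) h (r%:C * w ^+ i))).
apply: le_trans (ler_normD _ _) _; rewrite addrC; apply: lerD => //.
rewrite -[X in `|X|](subKr (\sum_(i < 2 ^ n) h (w ^+ i))).
by apply: le_trans (ler_normB _ _) _; apply: lerD.
Qed.

End MaximumPrinciple.

(** * The tetrablock *)

Section Algebra.
Variable R : realType.
Implicit Types (x : C3 R) (z w a b : C R).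

Definition bidisc_form x z w : C R := 1 - x.1.1 * z - x.1.2 * w + x.2 * z * w.

(* This is in fact the closure of the tetrablock; the inclusion proved below is
   the only one needed. *)
Definition weak_tetrablock : set (C3 R) :=
  [set x | forall z w, `|z| < 1 -> `|w| < 1 -> bidisc_form x z w != 0].

(** The weights 1, 1, 2 make this the substitution of (r z, r w) for (z, w) in [bidisc_form]. *)
Definition dilate (r : C R) x : C3 R := (r * x.1.1, r * x.1.2, r ^+ 2 * x.2).

Lemma dilate_tetrablock r x : weak_tetrablock x -> `|r| < 1 ->
  tetrablock (dilate r x).
Proof.
move=> Kx r1 z w z1 w1.
have rt (t : C R) : `|t| <= 1 -> `|r * t| < 1.
  by move=> t1; rewrite normrM (le_lt_trans _ r1)// ler_piMr.
have := Kx _ _ (rt z z1) (rt w w1).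
rewrite (_ : bidisc_form _ _ _ = 1 - (dilate r x).1.1 * z - (dilate r x).1.2 * w
  + (dilate r x).2 * z * w)//.
by rewrite /bidisc_form /dilate /=; ring.
Qed.

Lemma unimodular_rotation a : exists2 w : C R, `|w| = 1 & a * w = `|a|.
Proof.
have [->|a0] := eqVneq a 0; first by exists 1; rewrite ?normr1// mul0r normr0.
exists (`|a| / a); last by rewrite mulrC divfK.
by rewrite normrM normfV normr_id divff// normr_eq0.
Qed.

Lemma addC_le_norm a : a + a^* <= 2 * `|a|.
Proof.
have : a + a^* \is Num.real by rewrite CrealE rmorphD /= conjCK addrC.
move=> /real_ler_norm/le_trans; apply; apply: le_trans (ler_normD _ _) _.
by rewrite norm_conjC mulrDl mul1r.
Qed.

Lemma swap_tetrablock x : tetrablock x -> tetrablock (x.1.2, x.1.1, x.2).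
Proof.
move=> Ex z w z1 w1; have := Ex w z w1 z1; apply: contra_neq => /= <-; ring.
Qed.

(** Otherwise the form would vanish at (0, 1/x2), a point of the closed bidisc. *)
Lemma tetrablock_norm_lt1 x : tetrablock x -> `|x.1.2| < 1.
Proof.
move=> Ex; rewrite real_ltNge ?normr_real//; apply/negP => x1.
have x0 : x.1.2 != 0 by rewrite -normr_gt0 (lt_le_trans _ x1).
have := Ex 0 x.1.2^-1; rewrite normr0 normfV invf_le1 ?normr_gt0// => /(_ ler01 x1).
by rewrite !mulr0 mul0r subr0 addr0 divff// subrr eqxx.
Qed.

(** The form vanishes at z = (1 - x2 w)/(x1 - x3 w), so |x1 - x3 w| <= |1 - x2 w| whenever |w| = 1.
    Squaring, and choosing [w] to align the phase of the cross term, gives the inequality. *)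
Lemma tetrablock_defect x : tetrablock x ->
  2 * `|x.1.2 - x.2 * x.1.1^*| <= 1 + `|x.1.2| ^+ 2 - `|x.1.1| ^+ 2 - `|x.2| ^+ 2.
Proof.
move=> Ex; have [w w1 aw] := unimodular_rotation (x.1.2 - x.2 * x.1.1^*).
have ww : w * w^* = 1 by rewrite -normCK w1 expr1n.
have aw' : (x.1.2^* - x.2^* * x.1.1) * w^* = `|x.1.2 - x.2 * x.1.1^*|.
  by rewrite -conj_normC -aw !rmorphM /= rmorphB rmorphM /= conjCK.
suff H : `|x.1.1 - x.2 * w| ^+ 2 <= `|1 - x.1.2 * w| ^+ 2.
  rewrite -subr_ge0; move: H; rewrite -subr_ge0.
  suff -> : `|1 - x.1.2 * w| ^+ 2 - `|x.1.1 - x.2 * w| ^+ 2 = 1 + `|x.1.2| ^+ 2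
    - `|x.1.1| ^+ 2 - `|x.2| ^+ 2 - 2 * `|x.1.2 - x.2 * x.1.1^*| by [].
  rewrite [2 * _]mulr_natl mulr2n -[X in _ = _ - (_ + X)]aw' -[X in _ = _ - (X + _)]aw.
  rewrite !normCK !rmorphB !rmorphM /= rmorph1.
  transitivity (1 + x.1.2 * x.1.2^* * (w * w^*) - x.1.1 * x.1.1^* - x.2 * x.2^* * (w * w^*)
    - ((x.1.2 - x.2 * x.1.1^* ) * w + (x.1.2^* - x.2^* * x.1.1) * w^* )); first by ring.
  by rewrite ww; ring.
rewrite ler_pXn2r ?nnegrE// real_leNgt ?normr_real//; apply/negP => lt.
have x0 : x.1.1 - x.2 * w != 0 by rewrite -normr_gt0 (le_lt_trans _ lt).
have := Ex ((1 - x.1.2 * w) / (x.1.1 - x.2 * w)) w.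
rewrite normf_div ler_pdivrMr ?normr_gt0// mul1r w1 => /(_ (ltW lt) (lexx 1)).
move/eqP; apply; field; exact: x0.
Qed.

(* With all phases aligned, the left-hand side is a difference of two squares. *)
Lemma bidisc_real_ineq (p q b c : R) : 0 <= p < 1 -> 0 <= q < 1 -> 0 <= b -> 0 <= c ->
  b + c <= 1 ->
  0 < 1 - p ^+ 2 * q ^+ 2 + (b ^+ 2 - c ^+ 2) * (p ^+ 2 - q ^+ 2)
    - (1 - q ^+ 2) * (2 * (b * p)) - (1 - p ^+ 2) * (2 * (c * q)).
Proof.
move=> p1 q1 b0 c0 bc.
rewrite [ltRHS](_ : _ = (1 - p * q - (b - c) * (p - q)) * (1 + p * q - (b + c) * (p + q))).
  apply: mulr_gt0; last by nra.
  (* Since |b - c| <= 1, the first factor is at least 1 - p q - |p - q|, which is one of the next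
     two products according to the order of p and q. *)
  have : 0 < (1 - p) * (1 + q) by apply: mulr_gt0; lra.
  have : 0 < (1 + p) * (1 - q) by apply: mulr_gt0; lra.
  have [pq|pq] := leP p q; nra.
ring.
Qed.

(** The form is D + z N, where N is the reflection of D in the torus, so |N| < |D| suffices. In
    |D|^2 - |N|^2 the phases enter only through the real parts of b1 v and b2 w; bounding these by
    moduli leaves [bidisc_real_ineq]. *)
Lemma affine_disc_weak b1 b2 z : `|b1| + `|b2| <= 1 -> `|z| <= 1 ->
  weak_tetrablock (b1 + b2^* * z, b2 + b1^* * z, z).
Proof.
move=> b12 z1 v w v1 w1; rewrite /bidisc_form /=.
pose D := 1 - b1 * v - b2 * w; pose N := v * w - b2^* * v - b1^* * w.
suff ND : `|N| < `|D|.
  rewrite (_ : _ + _ = D + z * N); last by rewrite /D /N; ring.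
  rewrite addr_eq0; apply: contraTneq ND => ->.
  by rewrite normrN normrM -real_leNgt ?normr_real// ler_piMl.
suff : `|N| ^+ 2 < `|D| ^+ 2 by rewrite ltr_pXn2r ?nnegrE.
have E : `|D| ^+ 2 - `|N| ^+ 2 = 1 - `|v| ^+ 2 * `|w| ^+ 2
    + (`|b1| ^+ 2 - `|b2| ^+ 2) * (`|v| ^+ 2 - `|w| ^+ 2)
    - (1 - `|w| ^+ 2) * (b1 * v + (b1 * v)^* )
    - (1 - `|v| ^+ 2) * (b2 * w + (b2 * w)^* ).
  by rewrite !normCK /D /N !rmorphB !rmorphM /= rmorph1 !conjCK; ring.
rewrite -subr_gt0 E.
have H (t s : C R) : `|t| < 1 -> (1 - `|t| ^+ 2) * (s + s^* ) <= (1 - `|t| ^+ 2) * (2 * `|s|).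
  move=> t1; apply: ler_wpM2l (addC_le_norm s).
  by rewrite subr_ge0 expr_le1// ltW.
apply: lt_le_trans (lerB (lerB (lexx _) (H w (b1 * v) w1)) (H v (b2 * w) v1)).
rewrite !normrM.
(* Only moduli remain, so the inequality descends to [R]. *)
have nR (t : C R) : exists2 s : R, 0 <= s & `|t| = s%:C.
  exists (complex.Re `|t|); last by rewrite RRe_real// normr_real.
  by rewrite -lecR RRe_real ?normr_real//; exact: normr_ge0.
have [p p0 Ep] := nR v; have [q q0 Eq] := nR w.
have [b b0 Eb] := nR b1; have [c c0 Ec] := nR b2.
move: b12 v1 w1; rewrite Ep Eq Eb Ec -rmorphD -(rmorph1 (real_complex R)) lecR !ltcR.
move=> bc p1 q1.
have {}p1 : 0 <= p < 1 by rewrite p0 p1.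
have {}q1 : 0 <= q < 1 by rewrite q0 q1.
have := bidisc_real_ineq p1 q1 b0 c0 bc; rewrite -ltcR.
by rewrite !(rmorphB, rmorphD, rmorphM, rmorphXn, rmorph1, rmorph0, rmorph_nat) /=.
Qed.

End Algebra.

(** * Limits and inequalities on the closure *)

Section Topology.
Variable R : realType.
Implicit Types (x y : C3 R) (z w a b : C R).

Lemma conjC_continuous : continuous (fun z : C R => z^* : C R).
Proof.
move=> z; apply/(@cvgrPdist_lt (C R) (C R)^o _ _ (nbhs_filter z)) => e e0; apply/nbhs_normP.
by exists e => //= w; rewrite -rmorphB norm_conjC.
Qed.

Lemma real_complex_continuous : continuous (fun t : R => t%:C : C R).
Proof.
move=> t; apply/(@cvgrPdist_lt (C R) (C R)^o _ _ (nbhs_filter t)) => e e0.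
have eR : e = (complex.Re e)%:C by rewrite RRe_real// gtr0_real.
apply/nbhs_normP; exists (complex.Re e) => /=; first by rewrite -ltr0c -eR.
move=> s /= ts; rewrite -rmorphB normc_def /= expr0n /= addr0 sqrtr_sqr.
by rewrite eR ltcR.
Qed.

Lemma Re_continuous : continuous (fun z : C R => complex.Re z : R).
Proof.
move=> z; apply/(@cvgrPdist_lt R R^o _ _ (nbhs_filter z)) => e e0; apply/nbhs_normP.
exists e%:C => /=; first by rewrite ltr0c.
move=> w /= zw; rewrite -ltcR; apply: le_lt_trans zw.
rewrite (_ : _ - _ = complex.Re (z - w)); first exact: normc_ge_Re.
by case: z w => ? ? [].
Qed.

Section Cvg.
Variables (T : Type) (F : set_system T).
Context {FF : Filter F}.
Implicit Types f g : T -> C R.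

Lemma cvgCD f g a b : f @ F --> a -> g @ F --> b -> (fun t => f t + g t) @ F --> a + b.
Proof. move=> fa gb; apply: cvgD; [exact: fa|exact: gb]. Qed.

Lemma cvgCB f g a b : f @ F --> a -> g @ F --> b -> (fun t => f t - g t) @ F --> a - b.
Proof. move=> fa gb; apply: cvgB; [exact: fa|exact: gb]. Qed.

Lemma cvgCM f g a b : f @ F --> a -> g @ F --> b -> (fun t => f t * g t) @ F --> a * b.
Proof. move=> fa gb; apply: cvgM; [exact: fa|exact: gb]. Qed.

Lemma cvgC_dist_lt f a :
  f @ F --> a -> forall e : C R, 0 < e -> \forall t \near F, `|a - f t| < e.
Proof. by move=> fa; apply/(@cvgrPdist_lt (C R) (C R)^o). Qed.

End Cvg.

(** Here 0 <= a includes that a is real; it is expressed by the closed condition |a| = a. *)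
Lemma cvgC_ge0 (T : Type) (F : set_system T) {FF : ProperFilter F} (f : T -> C R) a :
  f @ F --> a -> (\forall t \near F, 0 <= f t) -> 0 <= a.
Proof.
move=> fa f0; rewrite ger0_def; apply: contrapT => /negP Fa.
pose d : C R := `| `|a| - a| / 2.
have d0 : 0 < d by rewrite divr_gt0// normr_gt0 subr_eq0.
have [t [ft0 ad]] := filter_ex (filterI f0 (cvgC_dist_lt fa d0)).
suff : `| `|a| - a| < d + d by rewrite /d -splitr ltxx.
apply: le_lt_trans (ler_distD `|f t| _ _) _.
apply: ltrD; first exact: le_lt_trans (ler_dist_dist _ _) ad.
by rewrite (ger0_norm ft0) distrC.
Qed.

Lemma closure_ge0 (A : set (C3 R)) (F : C3 R -> C R) : continuous F ->
  (forall x, A x -> 0 <= F x) -> forall x, closure A x -> 0 <= F x.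
Proof.
move=> cF F0 x clx; have PF := within_nbhs_proper clx.
have Fx : F @ within A (nbhs x) --> F x.
  by apply: cvg_trans (cF x); apply: cvg_app; exact: cvg_within.
apply: (cvgC_ge0 Fx); apply: (@filterS _ (nbhs x) _ setT) (filterT) => y _.
exact: F0.
Qed.

Lemma coord_continuous :
  [/\ continuous (fun x : C3 R => x.1.1), continuous (fun x : C3 R => x.1.2)
    & continuous (fun x : C3 R => x.2)].
Proof.
split=> x; last exact: cvg_snd.
  by apply: (@continuous_comp _ _ _ fst fst); exact: cvg_fst.
by apply: (@continuous_comp _ _ _ fst snd); [exact: cvg_fst|exact: cvg_snd].
Qed.

Lemma closure_defect y : closure (@tetrablock R) y ->
  2 * `|y.1.2 - y.2 * y.1.1^*| <= 1 + `|y.1.2| ^+ 2 - `|y.1.1| ^+ 2 - `|y.2| ^+ 2.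
Proof.
have [c1 c2 c3] := coord_continuous.
move=> cly; rewrite -subr_ge0.
pose F (x : C3 R) : C R := 1 + `|x.1.2| ^+ 2 - `|x.1.1| ^+ 2 - `|x.2| ^+ 2
  - 2 * `|x.1.2 - x.2 * x.1.1^*|.
apply: (@closure_ge0 (@tetrablock R) F) cly; last first.
  by move=> x /tetrablock_defect; rewrite subr_ge0.
move=> x; have sq (G : C3 R -> C R) : continuous G ->
    (fun x => `|G x| ^+ 2) @ x --> `|G x| ^+ 2.
  by move=> cG; apply: cvgCM; apply: cvg_norm; exact: cG.
have s1 := sq _ c1; have s2 := sq _ c2; have s3 := sq _ c3.
apply: cvgCB.
  apply: cvgCB; last exact: s3.
  apply: cvgCB; last exact: s1.
  by apply: cvgCD; [exact: cvg_cst|exact: s2].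
apply: cvgCM; first exact: cvg_cst.
apply: cvg_norm; apply: cvgCB; first exact: c2.
apply: cvgCM; first exact: c3.
exact: (cvg_comp _ _ (c1 x) (@conjC_continuous x.1.1)).
Qed.

End Topology.

(** * The set S: membership in the closure, closedness, compactness *)

Section UnitaryPoints.
Variable R : realType.
Implicit Types (x y p : C3 R) (z w a b : C R).

(** The set S of the overview, named after its description as the image of the unitary matrices
    under [tetra_pi]. *)
Definition unitary_points : set (C3 R) :=
  [set x | [/\ x.1.1 = x.1.2^* * x.2, `|x.2| = 1 & `|x.1.2| <= 1]].

Lemma cvg_C3 (T : Type) (F : set_system T) {FF : Filter F} (f g h : T -> C R) a b c :
  f @ F --> a -> g @ F --> b -> h @ F --> c ->
  (fun t => (f t, g t, h t) : C3 R) @ F --> ((a, b, c) : C3 R).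
Proof. move=> fa gb hc; exact: (cvg_pair (cvg_pair fa gb) hc). Qed.

Lemma cvg_dilate (T : Type) (F : set_system T) {FF : Filter F} (r : T -> C R)
    (q : T -> C3 R) x :
  r @ F --> (1 : C R) -> q @ F --> x -> (fun t => dilate (r t) (q t)) @ F --> x.
Proof.
move=> r1 qx; have [c1 c2 c3] := coord_continuous R.
have -> : x = (1 * x.1.1, 1 * x.1.2, (1 * 1) * x.2).
  by rewrite !mul1r; case: x {qx} => [[]].
apply: cvg_C3.
- by apply: cvgCM; [exact: r1|exact: (cvg_comp _ _ qx (c1 x))].
- by apply: cvgCM; [exact: r1|exact: (cvg_comp _ _ qx (c2 x))].
- apply: cvgCM; [|exact: (cvg_comp _ _ qx (c3 x))].
  by apply: cvgCM; exact: r1.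
Qed.

(** Real radii increasing to 1: in [C R] the condition 0 <= r < 1 forces r to be real. *)
Definition left_of_one : set_system (C R) := within [set r | 0 <= r < 1] (nbhs (1 : C R)).

Lemma left_of_one_proper : ProperFilter left_of_one.
Proof.
apply: Build_ProperFilter_ex => A /nbhs_normP[/= d d0 Hd].
have dR : d = (complex.Re d)%:C by rewrite RRe_real// gtr0_real.
have d0' : 0 < complex.Re d by rewrite -ltr0c -dR.
pose e := Num.min (2^-1) (complex.Re d / 2).
have e0 : 0 < e by rewrite lt_min divr_gt0// invr_gt0 ltr0n.
have e1 : e < 1 by rewrite gt_min invf_lt1// ltr1n.
have ed : e < complex.Re d by rewrite gt_min [X in _ || X]gtr_pMr// invf_lt1// ltr1n orbT.
exists (1 - e)%:C; apply: Hd => /=.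
  rewrite rmorphB rmorph1 opprB addrC subrK ger0_norm ?ler0c; last exact: ltW.
  by rewrite dR ltcR.
by rewrite -(rmorph1 (real_complex R)) ler0c ltcR; apply/andP; split; lra.
Qed.

Lemma left_of_one_cvg : (fun r : C R => r) @ left_of_one --> (1 : C R).
Proof. exact: cvg_within. Qed.

(** The dilates by r < 1 lie in the tetrablock and tend to [x]. *)
Lemma weak_closure x : weak_tetrablock x -> closure (@tetrablock R) x.
Proof.
move=> Kx B Bx; have FF := left_of_one_proper.
have B1 : \forall r \near left_of_one, B (dilate r x).
  exact: (cvg_dilate left_of_one_cvg (cvg_cst x)).
have : \forall r \near left_of_one, 0 <= r < 1 by apply: withinT; exact: nbhs_filter.
move=> /(filterI B1)/filter_ex[r [/= Br /andP[r0 r1]]].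
by exists (dilate r x); split=> //; apply: dilate_tetrablock; rewrite ?ger0_norm.
Qed.

(** Such a point lies on the affine disc with b1 = 0 and b2 = x2, at z = x3. *)
Lemma unitary_points_weak x : unitary_points x -> weak_tetrablock x.
Proof.
case: x => [[x1 x2] x3] [/= -> x31 x21].
have := @affine_disc_weak R 0 x2 x3; rewrite conjC0 mul0r add0r addr0 normr0 add0r.
by apply=> //; rewrite x31.
Qed.

Lemma closure_swap x : closure (@tetrablock R) x ->
  closure (@tetrablock R) ((x.1.2, x.1.1, x.2) : C3 R).
Proof.
have [c1 c2 c3] := coord_continuous R.
move=> clx B /(@cvg_C3 _ (nbhs x) _ _ _ _ _ _ _ (c2 x) (c1 x) (c3 x))/clx[y [Ey By]].
by exists (y.1.2, y.1.1, y.2); split=> //; exact: swap_tetrablock.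
Qed.

(** Adding the defect inequalities of [x] and of its swap cancels |x1|^2 and |x2|^2. *)
Lemma closure_defect_sum x : closure (@tetrablock R) x ->
  `|x.1.1 - x.1.2^* * x.2| + `|x.1.2 - x.1.1^* * x.2| <= 1 - `|x.2| ^+ 2.
Proof.
move=> clx; have := closure_defect clx.
have /= := closure_defect (closure_swap clx).
rewrite ![x.2 * _]mulrC => H1 H2.
rewrite -(@ler_pM2l _ 2)// mulrDr; apply: le_trans (lerD H1 H2) _.
by rewrite le_eqVlt; apply/orP; left; apply/eqP; ring.
Qed.

Lemma closure_norm_le1 x : closure (@tetrablock R) x ->
  `|x.1.2| <= 1 /\ `|x.2| <= 1.
Proof.
move=> clx; split; last first.
  have : 0 <= 1 - `|x.2| ^+ 2.
    by apply: le_trans (closure_defect_sum clx); apply: addr_ge0.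
  by rewrite subr_ge0 expr_le1.
have [c1 c2 c3] := coord_continuous R.
rewrite -subr_ge0; apply: (@closure_ge0 R (@tetrablock R) (fun x => 1 - `|x.1.2|)) clx.
  by move=> y; apply: cvgCB; [exact: cvg_cst|apply: cvg_norm; exact: c2].
by move=> y /tetrablock_norm_lt1/ltW; rewrite subr_ge0.
Qed.

(** When |x3| = 1, the right-hand side of [closure_defect_sum] vanishes and x1 = x2' x3 follows. The
    condition on |x3| takes the form required by [closure_ge0]. *)
Lemma unitary_pointsE : unitary_points =
  closure (@tetrablock R) `&` [set x | 0 <= `|x.2| - 1].
Proof.
apply/seteqP; split=> x.
  move=> Sx; split; first exact/weak_closure/unitary_points_weak.
  by case: Sx => _ /= -> _; rewrite subrr.
move=> [clx /=]; rewrite subr_ge0 => x31; have [x21 x31'] := closure_norm_le1 clx.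
have {x31 x31'} x3 : `|x.2| = 1 by apply/eqP; rewrite eq_le x31 x31'.
split=> //; have := closure_defect_sum clx.
rewrite x3 expr1n subrr => H; apply/eqP; rewrite -subr_eq0 -normr_le0.
by apply: le_trans H; rewrite lerDl.
Qed.

Lemma unitary_points_closed : closed unitary_points.
Proof.
rewrite unitary_pointsE; apply: closedI; first exact: closed_closure.
move=> x; apply: (closure_ge0 (F := fun x => `|x.2| - 1)) => //.
have [c1 c2 c3] := coord_continuous R.
by move=> y; apply: cvgCB; [apply: cvg_norm; exact: c3|exact: cvg_cst].
Qed.

Lemma Re_Im_cvg : continuous (fun q : R * R => Complex q.1 q.2 : C R).
Proof.
have -> : (fun q : R * R => Complex q.1 q.2 : C R) = (fun q => q.1%:C + 'i * q.2%:C).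
  by apply/funext => -[a b]; rewrite [LHS]complexE -complexiE.
move=> q.
have H1 : (fun p : R * R => p.1%:C : C R) @ q --> (q.1%:C : C R).
  by apply: (@continuous_comp _ _ _ fst (fun t : R => t%:C : C R));
    [exact: cvg_fst|exact: real_complex_continuous].
have H2 : (fun p : R * R => p.2%:C : C R) @ q --> (q.2%:C : C R).
  by apply: (@continuous_comp _ _ _ snd (fun t : R => t%:C : C R));
    [exact: cvg_snd|exact: real_complex_continuous].
exact: (cvgCD H1 (cvgCM (cvg_cst 'i) H2)).
Qed.

(** S is closed and contained in the image of the cube [-1, 1]^4, whose coordinates are the real and
    imaginary parts of x2 and x3. *)
Lemma unitary_points_compact : compact unitary_points.
Proof.
pose I := `[(-1 : R), 1]%classic.
pose Q (q : (R * R) * (R * R)) : C3 R :=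
  ((Complex q.1.1 q.1.2 : C R)^* * Complex q.2.1 q.2.2,
   Complex q.1.1 q.1.2, Complex q.2.1 q.2.2).
apply: (@subclosed_compact _ _ (Q @` ((I `*` I) `*` (I `*` I)))).
- exact: unitary_points_closed.
- apply: continuous_compact; last first.
    by do ! apply: compact_setX; exact: segment_compact.
  apply: continuous_subspaceT => q.
  have H1 : (fun q : (R * R) * (R * R) => Complex q.1.1 q.1.2 : C R) @ q
      --> (Complex q.1.1 q.1.2 : C R).
    by apply: (@continuous_comp _ _ _ fst (fun p : R * R => Complex p.1 p.2 : C R));
      [exact: cvg_fst|exact: Re_Im_cvg].
  have H2 : (fun q : (R * R) * (R * R) => Complex q.2.1 q.2.2 : C R) @ q
      --> (Complex q.2.1 q.2.2 : C R).
    by apply: (@continuous_comp _ _ _ snd (fun p : R * R => Complex p.1 p.2 : C R));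
      [exact: cvg_snd|exact: Re_Im_cvg].
  have H3 := @cvg_comp _ _ _ _ (fun z : C R => z^* : C R) _ _ _ H1 (@conjC_continuous R _).
  exact: (cvg_C3 (cvgCM H3 H2) H1 H2).
- move=> [[x1 x2] x3] [/= -> x31 x21].
  have H (z : C R) : `|z| <= 1 -> I (complex.Re z) /\ I (complex.Im z).
    move=> z1.
    have Hre (w : C R) : `|w| <= 1 -> I (complex.Re w).
      move=> w1; rewrite /I /= in_itv /= -ler_norml -lecR.
      exact: le_trans (normc_ge_Re w) w1.
    split; first exact: Hre.
    (* The imaginary part of z is the real part of -i z. *)
    have := Hre (- 'i * z); rewrite normrM normrN normCi mul1r => /(_ z1).
    by rewrite -complexiE; case: z {z1} => a b /=; simpc.
  exists ((complex.Re x2, complex.Im x2), (complex.Re x3, complex.Im x3)).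
    have [a b] := H x2 x21.
    by have := H x3; rewrite x31 lexx => /(_ isT)[c d].
  by rewrite /Q /=; case: x2 {x21} => a b; case: x3 {x31}.
Qed.

End UnitaryPoints.

(** * The maximum principle for the tetrablock algebra *)

Section Boundary.
Variable R : realType.
Implicit Types (x y p : C3 R) (z w a b : C R).

(** For |a| < 1, the disc automorphism taking 0 to [a]; it recentres an affine disc at a given
    point. *)
Definition moebius a z : C R := (z + a) / (1 + a^* * z).

Lemma moebius_den a z : `|a| < 1 -> `|z| <= 1 -> 1 + a^* * z != 0.
Proof.
move=> a1 z1; rewrite addr_eq0; apply/eqP => /(congr1 Num.norm).
rewrite normr1 normrN normrM norm_conjC => E.
suff : `|a| * `|z| < 1 by rewrite -E ltxx.
by rewrite (le_lt_trans _ a1)// ler_piMr.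
Qed.

Lemma moebius_norm a z : `|1 + a^* * z| ^+ 2 - `|z + a| ^+ 2 =
  (1 - `|a| ^+ 2) * (1 - `|z| ^+ 2).
Proof. by rewrite !normCK !rmorphD rmorphM /= conjCK rmorph1; ring. Qed.

Lemma moebius_le1 a z : `|a| < 1 -> `|z| <= 1 -> `|moebius a z| <= 1.
Proof.
move=> a1 z1; rewrite normf_div ler_pdivrMr ?normr_gt0 ?moebius_den// mul1r.
rewrite -(@ler_pXn2r _ 2)// ?nnegrE// -subr_ge0 moebius_norm.
by rewrite mulr_ge0// subr_ge0 expr_le1// ltW.
Qed.

Lemma moebius_eq1 a z : `|a| < 1 -> `|z| = 1 -> `|moebius a z| = 1.
Proof.
move=> a1 z1; rewrite normf_div.
suff -> : `|z + a| = `|1 + a^* * z|.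
  by rewrite divff// normr_eq0 moebius_den// z1.
apply/eqP; rewrite -(@eqrXn2 _ 2)// eq_sym -subr_eq0 moebius_norm z1.
by rewrite expr1n subrr mulr0.
Qed.

Lemma moebius_differentiable a z : `|a| < 1 -> `|z| <= 1 ->
  differentiable (moebius a) z.
Proof.
move=> a1 z1.
have did : differentiable (fun z : C R => z) z by apply: ex_diff; exact: is_diff_id.
have dD b c : differentiable (fun z : C R => b + c * z) z.
  apply: differentiableD; first exact: differentiable_cst.
  by apply: differentiableM; [exact: differentiable_cst|exact: did].
apply: differentiableM.
  by apply: differentiableD; [exact: did|exact: differentiable_cst].
by apply: differentiableV; [exact: dD|exact: moebius_den].
Qed.

(** Solving the two equations gives b1 (1 - |x3|^2) = x1 - x2' x3, and symmetrically for b2; then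
    [closure_defect_sum] says that |b1| + |b2| <= 1. *)
Lemma affine_disc_point x : closure (@tetrablock R) x -> `|x.2| < 1 ->
  exists b1 b2 : C R, `|b1| + `|b2| <= 1 /\
    x = (b1 + b2^* * x.2, b2 + b1^* * x.2, x.2).
Proof.
move=> clx x1; have := closure_defect_sum clx.
case: x x1 clx => [[x1 x2] x3] /= x31 _ H.
have c0 : 0 < 1 - `|x3| ^+ 2 by rewrite subr_gt0 exprn_ilt1.
have c0' : 1 - x3 * x3^* != 0 by rewrite -normCK gt_eqF.
exists ((x1 - x2^* * x3) / (1 - `|x3| ^+ 2)), ((x2 - x1^* * x3) / (1 - `|x3| ^+ 2)).
split.
  by rewrite !normf_div (ger0_norm (ltW c0)) -mulrDl ler_pdivrMr// mul1r.
rewrite !rmorphM !rmorphB !fmorphV !rmorphM !rmorphB /= !rmorph1 rmorphXn /=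
  conj_normC !conjCK.
rewrite !normCK; congr (_, _, _); by field.
Qed.

Lemma affine_disc_unitary b1 b2 z : `|b1| + `|b2| <= 1 -> `|z| = 1 ->
  unitary_points (b1 + b2^* * z, b2 + b1^* * z, z).
Proof.
move=> b12 z1; have zz : z^* * z = 1 by rewrite mulrC -normCK z1 expr1n.
split=> //=.
  by rewrite rmorphD rmorphM /= conjCK -[in LHS](mulr1 b1) -zz; ring.
apply: le_trans (ler_normD _ _) _.
by rewrite normrM norm_conjC z1 mulr1 addrC.
Qed.

(** As [f] is continuous only relative to the closure, the dilated points must be kept inside it. *)
Lemma dilate_tetra_algebra_cvg (f : C3 R -> C R) (T : Type) (F : set_system T)
    {FF : Filter F} (r : T -> C R) (q : T -> C3 R) x :
  tetra_algebra f -> closure (@tetrablock R) x ->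
  r @ F --> (1 : C R) -> q @ F --> x ->
  (\forall t \near F, `|r t| < 1) -> (\forall t \near F, weak_tetrablock (q t)) ->
  (fun t => f (dilate (r t) (q t))) @ F --> f x.
Proof.
move=> [/subspace_continuousP cf _] clx r1 qx Fr Fq.
have D : (fun t => dilate (r t) (q t)) @ F --> within (closure (@tetrablock R)) (nbhs x).
  move=> A HA; have H : \forall t \near F,
      closure (@tetrablock R) (dilate (r t) (q t)) -> A (dilate (r t) (q t)).
    exact: (cvg_dilate r1 qx HA).
  apply: filterS (filterI (filterI H Fr) Fq) => t [[/= Ht rt] qt].
  exact: (Ht (subset_closure (dilate_tetrablock qt rt))).
exact: (cvg_comp _ _ D (cf _ clx)).
Qed.

Lemma dilate_differentiable (u v t : C R -> C R) r z :
  differentiable u z -> differentiable v z -> differentiable t z ->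
  differentiable (fun z => dilate r (u z, v z, t z) : C3 R) z.
Proof.
move=> du dv dt; have dc c (g : C R -> C R) : differentiable g z ->
    differentiable (fun z => c * g z) z.
  by move=> dg; apply: differentiableM => //; exact: differentiable_cst.
by apply: differentiable_pair; [apply: differentiable_pair|]; apply: dc.
Qed.

(** A point with |y3| = 1 is in S. Any other is the centre of a reparametrised affine disc with
    boundary circle in S, and [norm_center_le] applies once the disc is contracted slightly. *)
Lemma unitary_points_bound (f : C3 R -> C R) (M : C R) y :
  tetra_algebra f -> (forall p, unitary_points p -> `|f p| <= M) ->
  closure (@tetrablock R) y -> `|f y| <= M.
Proof.
move=> Af fM cly.
have M0 : 0 <= M.
  have : unitary_points ((1, 1, 1) : C3 R) by split; rewrite /= ?conjC1 ?mulr1 ?normr1.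
  by move=> /fM; apply: le_trans.
have [y21 y31] := closure_norm_le1 cly.
move: y31; rewrite le_eqVlt => /predU1P[y31|y31].
  by apply: fM; rewrite unitary_pointsE; split=> //=; rewrite y31 subrr.
have [b1 [b2 [b12 ybE]]] := affine_disc_point cly y31.
have yK : weak_tetrablock y by rewrite ybE; apply: affine_disc_weak => //; exact: ltW.
rewrite real_leNgt ?ger0_real//; apply/negP => lt.
(* The errors at y and on S total at most 2 e, short of |f y| - M = 3 e. *)
pose e : C R := (`|f y| - M) / 3.
have e0 : 0 < e by rewrite divr_gt0// subr_gt0.
have PF := left_of_one_proper R; have FF : Filter (@left_of_one R) by exact: within_filter.
have r01 : \forall r \near @left_of_one R, 0 <= r < 1.
  by apply: withinT; exact: nbhs_filter.
have r1 : \forall r \near @left_of_one R, `|r| < 1.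
  by apply: filterS r01 => r /andP[r0 r1]; rewrite ger0_norm.
have H1 : \forall r \near @left_of_one R, `|f y - f (dilate r y)| < e.
  have yK' : \forall r \near @left_of_one R, weak_tetrablock y by exact: filterE.
  have H := dilate_tetra_algebra_cvg Af cly (@left_of_one_cvg R) (cvg_cst y) r1 yK'.
  exact: (cvgC_dist_lt (H FF FF) e0).
(* One radius must serve all points of S; compactness provides it. *)
have H2 : \forall r \near @left_of_one R,
    unitary_points (R := R) `<=` (fun p => `|f (dilate r p)| < M + e).
  have /compact_near_coveringP/near_covering_withinP := @unitary_points_compact R.
  apply => p Sp.
  pose G := filter_prod (within (@unitary_points R) (nbhs p)) (@left_of_one R).
  have FG : Filter G by exact: filter_prod_filter.
  have clp : closure (@tetrablock R) p by exact/weak_closure/unitary_points_weak.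
  have G1 : (fun q : C3 R * C R => q.2) @ G --> (1 : C R).
    move=> A A1; exists (setT, A); last by move=> q [].
    by split; [exact: filterT|exact: (@left_of_one_cvg R A A1)].
  have Gp : (fun q : C3 R * C R => q.1) @ G --> p.
    move=> A Ap; exists (A, setT); last by move=> q [].
    by split; [exact: cvg_within Ap|exact: filterT].
  have Gr : \forall q \near G, `|q.2| < 1.
    exists (setT, [set r : C R | `|r| < 1]); last by move=> q [].
    by split; [exact: filterT|exact: r1].
  have GK : \forall q \near G, weak_tetrablock q.1.
    exists (@weak_tetrablock R, setT); last by move=> q [].
    split; last exact: filterT.
    apply: (@filterS _ (nbhs p) _ setT) (filterT) => q _.
    exact: unitary_points_weak.
  have H := dilate_tetra_algebra_cvg Af clp G1 Gp Gr GK.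
  have [[U V] /= [HU HV] UV] := cvgC_dist_lt (H FG) e0.
  exists ([set q | unitary_points q -> U q], V) => //= -[q r] [/= Uq Vr] Sq.
  have := UV (q, r) (conj (Uq Sq) Vr) => /= {}H.
  rewrite -[f (dilate r q)](subKr (f p)).
  by apply: le_lt_trans (ler_normB _ _) _; apply: ler_ltD => //; exact: fM.
(* Contracting by r < 1 moves the closed affine disc into the open tetrablock,
   where f is differentiable. *)
have [r [[/= Hr1 Hr2] Hr]] := filter_ex (filterI (filterI H1 H2) r1).
suff : `|f (dilate r y)| <= M + e.
  move=> H.
  suff : `|f y| < e + (M + e).
    rewrite (_ : e + (M + e) = `|f y| - e); last by rewrite /e; field.
    by rewrite ltrBrDr gtrDl => /(lt_trans e0); rewrite ltxx.
  rewrite -[f y](subrK (f (dilate r y))).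
  by apply: le_lt_trans (ler_normD _ _) _; apply: ltr_leD.
(* The affine disc through y, with parameter shifted so that y sits at 0. *)
pose ph z : C3 R := (b1 + b2^* * moebius y.2 z, b2 + b1^* * moebius y.2 z, moebius y.2 z).
have ph0 : ph 0 = y by rewrite /ph /moebius mulr0 add0r addr0 divr1 -ybE.
rewrite -ph0; apply: (@norm_center_le R (fun z => f (dilate r (ph z)))).
  move=> z z1; have dm := moebius_differentiable y31 z1.
  have da b c : differentiable (fun z => b + c * moebius y.2 z) z.
    apply: differentiableD; first exact: differentiable_cst.
    by apply: differentiableM; first exact: differentiable_cst.
  apply: (@differentiable_comp _ _ _ _ (fun z => dilate r (ph z)) f).
    exact: dilate_differentiable.
  apply: Af.2; apply: dilate_tetrablock => //; apply: affine_disc_weak => //.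
  exact: moebius_le1.
move=> z z1; apply/ltW/Hr2/affine_disc_unitary => //.
exact: moebius_eq1.
Qed.

End Boundary.

(** * Peak points and the distinguished boundary *)

Section Peak.
Variable R : realType.
Implicit Types (x y p : C3 R) (z w a b c : C R).

Lemma coord_differentiable x :
  [/\ differentiable (fun y : C3 R => y.1.1 : C R) x,
      differentiable (fun y : C3 R => y.1.2 : C R) x
    & differentiable (fun y : C3 R => y.2 : C R) x].
Proof.
have d1 : differentiable (fun y : C3 R => y.1) x.
  by apply: linear_differentiable => y; exact: cvg_fst.
split; last by apply: linear_differentiable => y; exact: cvg_snd.
  apply: (@differentiable_comp _ _ _ _ (fun y : C3 R => y.1) fst) d1 _.
  by apply: linear_differentiable => y; exact: cvg_fst.
apply: (@differentiable_comp _ _ _ _ (fun y : C3 R => y.1) snd) d1 _.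
by apply: linear_differentiable => y; exact: cvg_snd.
Qed.

(** For |c| = 1 the first factor singles out x3 = c. On that slice of the closure c' x1 = x2', so
    the second factor is 1 - |x2 - b|^2 / 4. *)
Definition peak_function b c x : C R :=
  ((1 + c^* * x.2) / 2) ^+ 2 * (1 - (x.1.2 - b) * (c^* * x.1.1 - b^*) / 4).

Lemma peak_function_differentiable b c x : differentiable (peak_function b c) x.
Proof.
have [d1 d2 d3] := coord_differentiable x.
have dM (f g : C3 R -> C R) : differentiable f x -> differentiable g x ->
  differentiable (fun y => f y * g y) x by exact: differentiableM.
have dB (f g : C3 R -> C R) : differentiable f x -> differentiable g x ->
  differentiable (fun y => f y - g y) x by exact: differentiableB.
have dD (f g : C3 R -> C R) : differentiable f x -> differentiable g x ->
  differentiable (fun y => f y + g y) x by exact: differentiableD.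
have dc (a : C R) : differentiable (fun=> a : C R) x by exact: differentiable_cst.
have dh := dM _ _ (dD _ _ (dc 1) (dM _ _ (dc c^*) d3)) (dc 2^-1).
have dl := dM _ _ (dB _ _ d2 (dc b)) (dB _ _ (dM _ _ (dc c^*) d1) (dc b^*)).
exact: (dM _ _ (dM _ _ dh dh) (dB _ _ (dc 1) (dM _ _ dl (dc 4^-1)))).
Qed.

Lemma peak_function_algebra b c : tetra_algebra (peak_function b c).
Proof.
split; last by move=> x _; exact: peak_function_differentiable.
apply: continuous_subspaceT => x.
exact/differentiable_continuous/peak_function_differentiable.
Qed.

(** The bounds n e <= 2 (1 - s^2) and 2 n m <= n^2 + m^2 give h <= 1 + T - n^2 / 8, and (1 - T)(1 +
    T - n^2 / 8) = 1 - T^2 - (1 - T) n^2 / 8. If T = 0 then m = 0, so n > 0 makes it strict. *)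
Lemma peak_real_bound (s m n e h : R) :
  0 <= s <= 1 -> 0 <= m -> 0 <= n <= 2 -> e <= 1 - s ^+ 2 ->
  (1 - s ^+ 2) / 2 + m ^+ 2 / 4 <= 1 ->
  h <= 1 - n ^+ 2 / 4 + n * e / 4 + n * m / 4 ->
  0 < m \/ 0 < n ->
  (1 - ((1 - s ^+ 2) / 2 + m ^+ 2 / 4)) * h < 1.
Proof.
move=> /andP[s0 s1] m0 /andP[n0 n2] es; set T := _ / 2 + _ => T1 hle mn.
have s21 : 0 <= 1 - s ^+ 2 by rewrite subr_ge0 expr_le1.
have m2 : 0 <= m ^+ 2 by exact: sqr_ge0.
have T0 : 0 <= T by rewrite /T; lra.
have h1 : h <= 1 + T - n ^+ 2 / 8.
  apply: le_trans hle _.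
  have : n * e <= 2 * (1 - s ^+ 2) := le_trans (ler_wpM2l n0 es) (ler_wpM2r s21 n2).
  have : 0 <= (n - m) ^+ 2 by exact: sqr_ge0.
  by rewrite /T; nra.
apply: (@le_lt_trans _ _ ((1 - T) * (1 + T - n ^+ 2 / 8))).
  by rewrite ler_wpM2l// subr_ge0.
have [Tpos|Tneg] := ltP 0 T.
  have : 0 <= (1 - T) * n ^+ 2 by rewrite mulr_ge0 ?subr_ge0// sqr_ge0.
  by nra.
have TE : T = 0 by apply/eqP; rewrite eq_le Tneg T0.
case: mn => [mpos|npos]; last by rewrite TE; nra.
have : 0 < m ^+ 2 by rewrite exprn_gt0.
by move: Tneg; rewrite /T; lra.
Qed.

Lemma real_partC z : z \is Num.real -> exists s : R, z = s%:C.
Proof. by move=> zr; exists (complex.Re z); rewrite RRe_real. Qed.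

Lemma peak_function_lt1 b c y : `|c| = 1 -> `|b| <= 1 ->
  closure (@tetrablock R) y -> y <> (b^* * c, b, c) -> `|peak_function b c y| < 1.
Proof.
move=> c1 b1 cly yp.
have cc : c^* * c = 1 by rewrite mulrC -normCK c1 expr1n.
have [y21 y31] := closure_norm_le1 cly.
have dy : `|y.1.1 - y.1.2^* * y.2| <= 1 - `|y.2| ^+ 2.
  by apply: le_trans (closure_defect_sum cly); rewrite lerDl.
(* The coordinate u is rotated to peak at 1, v is the displacement of x2, and d is the defect,
   bounded by 1 - |u|^2. *)
pose u := c^* * y.2; pose v := y.1.2 - b; pose d := c^* * (y.1.1 - y.1.2^* * y.2).
have uE : `|u| = `|y.2| by rewrite normrM norm_conjC c1 mul1r.
have v2 : `|v| <= 2 by apply: le_trans (ler_normB _ _) _; apply: lerD.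
have dE : `|d| <= 1 - `|u| ^+ 2 by rewrite uE normrM norm_conjC c1 mul1r.
(* If u = 1 and v = 0, the defect bound becomes 0 and determines the first coordinate, so y would be
   the peak point. *)
have mn : 0 < `|u - 1| \/ 0 < `|v|.
  rewrite !normr_gt0; have [u1|] := eqVneq (u - 1) 0; last by left.
  have [v0|] := eqVneq v 0; last by right.
  exfalso; apply: yp; move/eqP: u1; rewrite subr_eq0 => /eqP u1.
  have y3 : y.2 = c by rewrite -[LHS]mul1r -cc mulrAC -/u u1 mul1r.
  have y2 : y.1.2 = b by apply/eqP; rewrite -subr_eq0 -/v v0.
  move: dy; rewrite y3 c1 expr1n subrr normr_le0 subr_eq0 y2 => /eqP y1.
  by rewrite [LHS](surjective_pairing y) (surjective_pairing y.1) y1 y2 y3.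
rewrite normrM normrX normf_div.
(* The parallelogram law for 1 + u and u - 1. *)
have -> : (`|1 + c^* * y.2| / `|2|) ^+ 2 = 1 - ((1 - `|u| ^+ 2) / 2 + `|u - 1| ^+ 2 / 4) :> C R.
  rewrite expr_div_n (ger0_norm (ler0n _ 2)) !normCK -/u !rmorphB !rmorphD rmorph1.
  by field.
have hb : `|1 - (y.1.2 - b) * (c^* * y.1.1 - b^*) / 4| <=
    1 - `|v| ^+ 2 / 4 + `|v| * `|d| / 4 + `|v| * `|u - 1| / 4.
  (* Here c' y1 - b' = v' + d + y2' (u - 1). *)
  have -> : 1 - (y.1.2 - b) * (c^* * y.1.1 - b^*) / 4 =
      (1 - `|v| ^+ 2 / 4) - v * d / 4 - v * y.1.2^* * (u - 1) / 4.
    by rewrite normCK /v /d /u rmorphB; field.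
  have n4 : `|4| = 4 :> C R by rewrite ger0_norm.
  apply: le_trans (ler_normB _ _) (lerD _ _).
    apply: le_trans (ler_normB _ _) (lerD _ _).
      rewrite ger0_norm// subr_ge0 ler_pdivrMr// mul1r.
      by rewrite (_ : 4 = 2 ^+ 2) ?lerXn2r ?nnegrE// -natrX.
    by rewrite normf_div n4 normrM.
  rewrite normf_div n4 !normrM norm_conjC ler_pM2r ?invr_gt0//.
  by rewrite ler_wpM2r// ler_piMr.
have T1 : (1 - `|u| ^+ 2) / 2 + `|u - 1| ^+ 2 / 4 <= 1.
  rewrite -subr_ge0.
  suff -> : 1 - ((1 - `|u| ^+ 2) / 2 + `|u - 1| ^+ 2 / 4) = (`|1 + u| / 2) ^+ 2.
    by apply: exprn_ge0; apply: divr_ge0.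
  by rewrite expr_div_n !normCK !rmorphB !rmorphD rmorph1; field.
have u1 : 0 <= `|u| <= 1 by rewrite normr_ge0 uE.
have v2' : 0 <= `|v| <= 2 by rewrite normr_ge0.
have m0 := normr_ge0 (u - 1).
move: T1 hb mn dE u1 v2' m0.
have [s ->] := real_partC (normr_real u).
have [m ->] := real_partC (normr_real (u - 1)).
have [n ->] := real_partC (normr_real v).
have [e ->] := real_partC (normr_real d).
have [h ->] := real_partC (normr_real (1 - (y.1.2 - b) * (c^* * y.1.1 - b^*) / 4)).
move=> T1 hb mn dE u1 v2' m0.
rewrite (_ : (1 - _) * _ = ((1 - ((1 - s ^+ 2) / 2 + m ^+ 2 / 4)) * h)%:C); last first.
  by rewrite !(rmorphB, rmorphD, rmorphM, fmorphV, rmorphXn, rmorph1, rmorph_nat).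
rewrite -(rmorph1 (real_complex R)) ltcR; apply: (@peak_real_bound s m n e h).
- by rewrite -!lecR rmorph1 rmorph0.
- by rewrite -lecR rmorph0.
- by rewrite -!lecR rmorph_nat rmorph0.
- by rewrite -lecR !(rmorphB, rmorphXn, rmorph1).
- by rewrite -lecR !(rmorphB, rmorphD, rmorphM, fmorphV, rmorphXn, rmorph1, rmorph_nat).
- by rewrite -lecR !(rmorphB, rmorphD, rmorphM, fmorphV, rmorphXn, rmorph1, rmorph_nat).
- by rewrite -!ltr0c.
Qed.

End Peak.

Section Characterizations.
Variable R : realType.
Implicit Types (x y p : C3 R) (z w a b c : C R).

Lemma unitary_points_closure x : unitary_points x -> closure (@tetrablock R) x.
Proof. by move=> /unitary_points_weak/weak_closure. Qed.

Lemma unitary_points_peak x : unitary_points x -> peak_point x.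
Proof.
move=> Sx; split; first exact: unitary_points_closure.
case: x Sx => [[x1 x2] x3] [/= -> x31 x21].
have xx : x3^* * x3 = 1 by rewrite mulrC -normCK x31 expr1n.
exists (peak_function x2 x3); split; first exact: peak_function_algebra.
  rewrite /peak_function /= xx subrr !mul0r subr0 mulr1.
  by rewrite -[1 + 1]/(2%:R) divff ?expr1n// pnatr_eq0.
by move=> y cly yp; apply: peak_function_lt1.
Qed.

(** On the compact set S the modulus attains its maximum, and [unitary_points_bound] carries this
    bound to the closure. The extreme value theorem is applied to the real part of |f|, a function
    with values in [R]. *)
Lemma boundary_unitary_points : boundary_for_tetrablock (@unitary_points R).
Proof.
split=> [x /unitary_points_closure//|f Af].
have [||p Sp pmax] := @compact_EVT_max (C3 R) R (fun x => complex.Re `|f x|)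
    (@unitary_points R) _    (@unitary_points_compact R).
- by exists (1, 1, 1); split; rewrite /= ?conjC1 ?mulr1 ?normr1.
- apply/subspace_continuousP => x Sx.
  have /subspace_continuousP/(_ _ (unitary_points_closure Sx)) H := Af.1.
  have H' : f @ within (@unitary_points R) (nbhs x) --> f x.
    apply: cvg_trans H; apply: cvg_app; apply: within_subset.
    exact: unitary_points_closure.
  have H2 := @cvg_comp _ _ _ _ (fun z : C R => complex.Re z) _ _ _
    (cvg_norm H') (@Re_continuous R _).
  exact: H2.
have reN z : `|z| = (complex.Re `|z|)%:C by rewrite RRe_real ?normr_real.
exists p => [|y cly]; first exact: set_mem.
apply: (unitary_points_bound Af) cly => q Sq.
by rewrite reN [leRHS]reN lecR; apply: pmax; rewrite inE.
Qed.

(** A peaking function attains its maximum modulus only at its peak. *)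
Lemma peak_point_boundary x (B : set (C3 R)) : peak_point x -> boundary_for_tetrablock B -> B x.
Proof.
move=> [clx [g [Ag gx g1]]] [Bcl HB]; have [p Bp pmax] := HB g Ag.
have [<-//|px] := pselect (p = x).
have := pmax x clx; rewrite gx normr1 => /(lt_le_trans (g1 p (Bcl _ Bp) px)).
by rewrite ltxx.
Qed.

Lemma peak_pointE x : peak_point x <-> unitary_points x.
Proof.
split; last exact: unitary_points_peak.
by move=> /peak_point_boundary; apply; exact: boundary_unitary_points.
Qed.

Lemma distinguished_boundaryE x : distinguished_boundary x <-> unitary_points x.
Proof.
have Sbd := boundary_unitary_points; have Scl := @unitary_points_closed R.
split=> [[B [_ _ Bmin] Bx]|Sx]; first exact: (Bmin _ Scl Sbd).
exists (@unitary_points R) => //; split=> // B' _ B'bd y Sy.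
exact: peak_point_boundary (unitary_points_peak Sy) B'bd.
Qed.

(** * Unitary matrices and their images under [tetra_pi] *)

Lemma det_mx22 (K : comNzRingType) (A : 'M[K]_2) :
  \det A = A 0 0 * A 1 1 - A 0 1 * A 1 0.
Proof.
rewrite (expand_det_row _ 0) !big_ord_recl big_ord0 addr0 /cofactor.
have -> : lift ord0 ord0 = 1 :> 'I_2 by apply/val_inj.
have E (B : 'M[K]_1) : \det B = B 0 0.
  by rewrite [B]mx11_scalar det_scalar1 !mxE.
rewrite !E !mxE /= !(expr0, expr1) mul1r mulN1r mulrN.
by congr (_ * A _ _ - _ * A _ _); apply/val_inj.
Qed.

Lemma unitarymx2P (U : 'M[C R]_2) :
  U \is unitarymx <-> forall i j, U i 0 * (U j 0)^* + U i 1 * (U j 1)^* = (i == j)%:R.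
Proof.
have E i j : (U *m U^t*%sesqui) i j = U i 0 * (U j 0)^* + U i 1 * (U j 1)^*.
  rewrite !mxE !big_ord_recl big_ord0 addr0 !mxE.
  by have -> : lift ord0 ord0 = 1 :> 'I_2 by apply/val_inj.
split=> [/unitarymxP UU i j|UU]; first by rewrite -E UU mxE.
by apply/unitarymxP/matrixP => i j; rewrite E UU mxE.
Qed.

Lemma unitary_tetra_pi (U : 'M[C R]_2) : U \is unitarymx -> unitary_points (tetra_pi U).
Proof.
move=> /unitarymx2P E.
have := E 0 0; have := E 0 1; have := E 1 0; have := E 1 1.
rewrite /unitary_points /tetra_pi det_mx22 /=.
move: (U 0 0) (U 0 1) (U 1 0) (U 1 1) => a b c d E11 E10 E01 E00.
split.
(* Orthonormality of the rows gives a; expanding gives d' (a d - b c). *)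
- transitivity (a * (c * c^* + d * d^*) - c * (a * c^* + b * d^*)); last by ring.
  by rewrite E11 E01 mulr1 mulr0 subr0.
- apply/eqP; rewrite -(@eqrXn2 _ 2)// expr1n normCK rmorphB !rmorphM /=; apply/eqP.
  (* Lagrange's identity *)
  transitivity ((a * a^* + b * b^*) * (c * c^* + d * d^*)
    - (a * c^* + b * d^*) * (c * a^* + d * b^*)); first by ring.
  by rewrite E00 E11 E01 mul0r subr0 mulr1.
- rewrite -(@ler_pXn2r _ 2)// ?nnegrE// expr1n normCK.
  have -> : 1 = c * c^* + d * d^* by rewrite E11.
  by rewrite lerDr mul_conjC_ge0.
Qed.

(** The diagonal is prescribed and the determinant forces the off-diagonal entry b to satisfy b^2 =
    x1 x2 - x3 = -(1 - |x2|^2) x3. The root b = i t s also satisfies b + x3 b' = 0, the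
    orthogonality of the rows. *)
Lemma unitary_points_symmetric x : unitary_points x ->
  exists U : 'M[C R]_2, [/\ U \is unitarymx, U^T = U & x = tetra_pi U].
Proof.
case: x => [[x1 x2] x3] [/= -> x31 x21].
pose t := sqrtC (1 - `|x2| ^+ 2); pose s := sqrtC x3; pose b := 'i * t * s.
have t0 : 0 <= t by rewrite sqrtC_ge0 subr_ge0 expr_le1.
have t2 : t ^+ 2 = 1 - x2 * x2^* by rewrite sqrtCK normCK.
have tJ : t^* = t by apply/CrealP; exact: ger0_real.
have s2 : s ^+ 2 = x3 by rewrite sqrtCK.
have ss : s * s^* = 1.
  rewrite -normCK; apply/eqP; rewrite -(@eqrXn2 _ 2)// ?exprn_ge0// expr1n.
  by rewrite exprAC -normrX s2 x31 expr1n.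
have i2 : 'i * 'i = -1 :> C R by rewrite -expr2 sqrCi.
have bJ : b^* = - 'i * t * s^* by rewrite /b !rmorphM /= conjCi tJ.
have bb : b * b^* = 1 - x2 * x2^*.
  rewrite bJ -t2 /b; transitivity (- ('i * 'i) * t ^+ 2 * (s * s^*)); first by ring.
  by rewrite i2 ss opprK mul1r mulr1.
have b2 : b * b = - (1 - x2 * x2^*) * x3.
  rewrite -t2 -s2 /b; transitivity (('i * 'i) * t ^+ 2 * s ^+ 2); first by ring.
  by rewrite i2 mulN1r.
have bs : b + x3 * b^* = 0.
  rewrite bJ -s2 /b; transitivity ('i * t * s * (1 - s * s^*)); first by ring.
  by rewrite ss subrr mulr0.
have x3J : x3 * x3^* = 1 by rewrite -normCK x31 expr1n.
pose U : 'M[C R]_2 := \matrix_(i, j)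
  (if i == j then if i == 0 then x2^* * x3 else x2 else b).
have I2 (i : 'I_2) : i = 0 \/ i = 1.
  by case: i => [[|[]]] // ?; [left|right]; apply/val_inj.
exists U; split.
- apply/unitarymx2P => i j; rewrite !mxE.
  have bsJ : b^* + x3^* * b = 0 by rewrite -[LHS]conjCK rmorphD rmorphM /= !conjCK bs conjC0.
  case: (I2 i) => ->; case: (I2 j) => -> /=.
  + rewrite bb rmorphM /= conjCK.
    transitivity (x2 * x2^* * (x3 * x3^*) + (1 - x2 * x2^*)); first by ring.
    by rewrite x3J; ring.
  + transitivity (x2^* * (b + x3 * b^*)); first by ring.
    by rewrite bs mulr0.
  + rewrite rmorphM /= conjCK; transitivity (x2 * (b^* + x3^* * b)); first by ring.
    by rewrite bsJ mulr0.
  + by rewrite bb; ring.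
- by apply/matrixP => i j; rewrite !mxE eq_sym; case: eqVneq => [->|].
- rewrite /tetra_pi det_mx22 !mxE /=; congr (_, _, _).
  by rewrite b2; ring.
Qed.

Lemma closure_norm1_unitary x : closure (@tetrablock R) x /\ `|x.2| = 1 <-> unitary_points x.
Proof.
rewrite unitary_pointsE; split=> [[clx x3]|[clx /= x3]]; split=> //=.
  by rewrite x3 subrr.
have [_ x3'] := closure_norm_le1 clx.
by apply/eqP; rewrite eq_le x3' -subr_ge0.
Qed.

End Characterizations.

(** * Automorphisms of the disc *)

Section Mobius.
Variable R : realType.
Implicit Types (x y p : C3 R) (z w a b c : C R).

Lemma fractional_linear_differentiable a b c d z : c * z + d != 0 ->
  differentiable (fun z : C R => (a * z + b) / (c * z + d)) z.
Proof.
move=> nz; have did : differentiable (fun z : C R => z) z by apply: ex_diff; exact: is_diff_id.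
have dl (u v : C R) : differentiable (fun z : C R => u * z + v) z.
  by apply: differentiableD; [apply: differentiableM|];
    [exact: differentiable_cst|exact: did|exact: differentiable_cst].
by apply: differentiableM; [exact: dl|apply: differentiableV; [exact: dl|exact: nz]].
Qed.

(** Since x1 x2 differs from x3, |x2| < 1. For [Psi] and its inverse alike, |denominator|^2 -
    |numerator|^2 is (1 - |x2|^2)(1 - |z|^2), which is positive on the disc. *)
Lemma disc_automorphism_unitary x : unitary_points x -> x.1.1 * x.1.2 <> x.2 ->
  disc_automorphism (fun z => Psi z x).
Proof.
case: x => [[x1 x2] x3] [/= x1E x31 x21 ne].
have x33 : x3 * x3^* = 1 by rewrite -normCK x31 expr1n.
have x2lt : `|x2| < 1.
  rewrite lt_neqAle x21 andbT; apply/eqP => x2E; apply: ne.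
  by rewrite x1E mulrAC [_ * x2]mulrC -normCK x2E expr1n mul1r.
have neq : x3 - x1 * x2 != 0 by rewrite subr_eq0 eq_sym; apply/eqP.
have lt1 (u v : C R) : `|u| <= 1 -> `|v| < 1 -> `|u * v| < 1.
  by move=> u1 v1; rewrite normrM (le_lt_trans _ v1)// ler_piMl.
have den z : disc z -> x2 * z - 1 != 0.
  move=> z1; rewrite subr_eq0; apply/eqP => E; have := lt1 _ _ x21 z1.
  by rewrite E normr1 ltxx.
have den' z : disc z -> x2 * z - x3 != 0.
  move=> z1; rewrite subr_eq0; apply/eqP => E; have := lt1 _ _ x21 z1.
  by rewrite E x31 ltxx.
have pos z : disc z -> 0 < (1 - `|x2| ^+ 2) * (1 - `|z| ^+ 2).
  by move=> z1; rewrite mulr_gt0// subr_gt0 exprn_ilt1.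
have quot (u v : C R) z : disc z -> v != 0 ->
    `|v| ^+ 2 - `|u| ^+ 2 = (1 - `|x2| ^+ 2) * (1 - `|z| ^+ 2) -> disc (u / v).
  move=> z1 v0 E; rewrite /disc /= normf_div ltr_pdivrMr ?normr_gt0// mul1r.
  by rewrite -(@ltr_pXn2r _ 2)// ?nnegrE// -subr_gt0 E pos.
split; first by move=> z z1; apply: fractional_linear_differentiable; exact: den.
(* The solution of Psi(w) = z; the factor 1 gives it the shape of
   [fractional_linear_differentiable]. *)
exists (fun z => (1 * z - x1) / (x2 * z - x3)); split.
- by move=> z z1; apply: fractional_linear_differentiable; exact: den'.
- move=> z z1; have d0 := den z z1; have fz : disc (Psi z (x1, x2, x3)).
    apply: (quot _ _ z) => //=; rewrite x1E !normCK !rmorphB !rmorphM rmorph1 /= !conjCK.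
    transitivity (1 - x2 * z - x2^* * z^* + x2 * x2^* * z * z^*
      - x3 * x3^* * (z * z^* - z * x2 - x2^* * z^* + x2 * x2^*)); first by ring.
    by rewrite x33; ring.
  split=> //; rewrite /Psi /= mul1r.
  have -> : (x3 * z - x1) / (x2 * z - 1) - x1 = (x3 - x1 * x2) * z / (x2 * z - 1) by field.
  have -> : x2 * ((x3 * z - x1) / (x2 * z - 1)) - x3 = (x3 - x1 * x2) / (x2 * z - 1) by field.
  by field; rewrite neq d0.
- move=> z z1; have d0 := den' z z1; split.
    apply: (quot _ _ z) => //=; rewrite mul1r x1E !normCK !rmorphB !rmorphM /= !conjCK.
    transitivity (x3 * x3^* - x2 * z * x3^* - x3 * x2^* * z^* + x2 * x2^* * z * z^*
      - z * z^* + z * x2 * x3^* + x2^* * x3 * z^* - x2 * x2^* * (x3 * x3^*)); first by ring.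
    by rewrite x33; ring.
  rewrite /Psi /= mul1r.
  have -> : x3 * ((z - x1) / (x2 * z - x3)) - x1 = - (x3 - x1 * x2) * (- z) / (x2 * z - x3).
    by field.
  have -> : x2 * ((z - x1) / (x2 * z - x3)) - 1 = (x3 - x1 * x2) / (x2 * z - x3) by field.
  by field; rewrite neq d0.
Qed.

Lemma normCB2 a b : `|a - b| ^+ 2 = `|a| ^+ 2 + `|b| ^+ 2 - (a * b^* + (a * b^*)^*).
Proof. by rewrite !normCK !rmorphB !rmorphM /= !conjCK; ring. Qed.

(** * An automorphism Psi comes from a point of S *)

Section Converse.
Variables x1 x2 x3 : C R.
Hypothesis ne : x1 * x2 <> x3.
Hypothesis aut : disc_automorphism (fun z => Psi z (x1, x2, x3)).

(** Away from the pole, positivity means that [Psi] takes a value in the disc. *)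
Let gap t : C R := `|x2 * t - 1| - `|x3 * t - x1|.

Let gap_gt0 z : `|z| < 1 -> x2 * z != 1 -> 0 < gap z.
Proof.
move=> z1 p; have [_ [g [_ /(_ z z1)[+ _] _]]] := aut.
rewrite /disc /Psi /= normf_div ltr_pdivrMr ?normr_gt0 ?subr_eq0// mul1r.
by rewrite subr_gt0.
Qed.

Let gap_limit z : (forall t : C R, 0 <= t < 1 -> 0 < gap (t * z)) -> 0 <= gap z.
Proof.
move=> H; have FF := left_of_one_proper R.
have F' : Filter (@left_of_one R) by exact: within_filter.
have tz : (fun t : C R => t * z) @ @left_of_one R --> z.
  rewrite -[X in _ --> X]mul1r.
  exact: (cvgCM (@left_of_one_cvg R) (cvg_cst z)).
have lin (u v : C R) : (fun t : C R => `|u * (t * z) - v|) @ @left_of_one R --> `|u * z - v|.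
  exact: (cvg_norm (cvgCB (cvgCM (cvg_cst u) tz) (cvg_cst v))).
have L : (fun t => gap (t * z)) @ @left_of_one R --> gap z.
  exact: (cvgCB (lin x2 1) (lin x3 x1)).
have near01 : \forall t \near @left_of_one R, 0 <= t < 1 by apply: withinT; exact: nbhs_filter.
have gap0 : \forall t \near @left_of_one R, 0 <= gap (t * z).
  by apply: filterS near01 => t /H/ltW.
exact: (cvgC_ge0 L gap0).
Qed.

Let gap_lt0_pole z : x2 * z = 1 -> gap z < 0.
Proof.
move=> E; rewrite /gap E subrr normr0 sub0r oppr_lt0 normr_gt0 subr_eq0.
by apply/eqP => E3; apply: ne; rewrite -E3 mulrAC -mulrA E mulr1.
Qed.

(** On the segment from 0 to a pole z one has x2 t z = t < 1, so the gap is positive there and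
    non-negative at z; but it is negative at a pole. *)
Let no_pole z : `|z| <= 1 -> x2 * z != 1.
Proof.
move=> z1; apply/eqP => E; suff /le_lt_trans/(_ (gap_lt0_pole E)) : 0 <= gap z.
  by rewrite ltxx.
apply: gap_limit => t /andP[t0 t1]; apply: gap_gt0.
  by rewrite normrM (ger0_norm t0) (le_lt_trans _ t1)// ler_piMr.
by rewrite mulrCA E mulr1 lt_eqF.
Qed.

(** A positive gap would put Psi(z) in the disc, hence Psi(z) = Psi(w) with |w| < 1; as x1 x2
    differs from x3, [Psi] is injective off its pole, so w = z. *)
Let gap_circle z : `|z| = 1 -> gap z = 0.
Proof.
move=> z1; have z1' : `|z| <= 1 by rewrite z1.
have : 0 <= gap z.
  apply: gap_limit => t /andP[t0 t1].
  have tz : `|t * z| < 1 by rewrite normrM (ger0_norm t0) z1 mulr1.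
  by apply: gap_gt0 => //; apply: no_pole; exact: ltW.
rewrite le_eqVlt => /predU1P[//|gz].
have [_ [g [_ _ gP]]] := aut.
have d0 : x2 * z - 1 != 0 by rewrite subr_eq0 no_pole.
have fz : disc (Psi z (x1, x2, x3)).
  by rewrite /disc /Psi /= normf_div ltr_pdivrMr ?normr_gt0// mul1r -subr_gt0.
have [w1] := gP _ fz; set w := g _ in w1 *.
have e0 : x2 * w - 1 != 0 by rewrite subr_eq0 no_pole// ltW.
rewrite /Psi /= => /eqP; rewrite eqr_div// => /eqP E.
have /eqP : (x1 * x2 - x3) * (w - z) = 0.
  rewrite -(subrr ((x3 * z - x1) * (x2 * w - 1))) -[X in _ = X - _]E; ring.
rewrite mulf_eq0 subr_eq0 (negbTE (introN eqP ne)) subr_eq0 /= => /eqP wz.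
by move: w1; rewrite /disc /= wz z1 ltxx.
Qed.

(** Squaring [gap_circle] gives 2 Re(a z) = k on the whole unit circle. The points 1 and -1 give k =
    0, and aligning the phase gives a = 0. Then k = (1 - |x1|^2)(1 - |x3|^2), where |x1| < 1 because
    Psi(0) = x1. *)
Lemma unitary_of_disc_automorphism : unitary_points ((x1, x2, x3) : C3 R).
Proof.
pose a := x2 - x3 * x1^*; pose k := 1 + `|x2| ^+ 2 - `|x1| ^+ 2 - `|x3| ^+ 2.
have circle z : `|z| = 1 -> a * z + (a * z)^* = k.
  move=> z1; have /eqP := gap_circle z1.
  rewrite subr_eq0 => /eqP/(congr1 (fun u => u ^+ 2)) /=.
  rewrite !normCB2 !normrM z1 normr1 conjC1 expr1n !mulr1 => /eqP.
  rewrite -subr_eq0 => /eqP E.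
  rewrite -[LHS]addr0 -E /k (_ : a * z = x2 * z - x3 * z * x1^*); last by rewrite /a; ring.
  by rewrite rmorphB; ring.
have k0 : k = 0.
  have /circle := normr1 (C R); have /circle : `|-1 : C R| = 1 by rewrite normrN normr1.
  rewrite mulrN mulr1 rmorphN => E1 E2.
  have /eqP : k + k = 0 by rewrite -{1}E1 -E2; ring.
  by rewrite -mulr2n mulrn_eq0 => /eqP.
have a0 : a = 0.
  have [w w1 aw] := unimodular_rotation a; have := circle w w1.
  rewrite k0 aw conj_normC => /eqP; rewrite -mulr2n mulrn_eq0 /= normr_eq0.
  by move/eqP.
have x2E : x2 = x3 * x1^* by apply/eqP; rewrite -subr_eq0 -/a a0.
have x11 : `|x1| < 1.
  have := gap_gt0 (z := 0); rewrite normr0 ltr01 mulr0 eq_sym oner_eq0 => /(_ isT isT).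
  by rewrite /gap !mulr0 !sub0r !normrN normr1 subr_gt0.
have /eqP : (1 - `|x1| ^+ 2) * (1 - `|x3| ^+ 2) = 0.
  rewrite -k0 /k x2E normrM norm_conjC; ring.
rewrite mulf_eq0 subr_eq0 gt_eqF ?exprn_ilt1//= subr_eq0 eq_sym sqrp_eq1// => /eqP x31.
have x33 : x3^* * x3 = 1 by rewrite mulrC -normCK x31 expr1n.
split=> //=; last by rewrite x2E normrM norm_conjC x31 mul1r ltW.
by rewrite x2E rmorphM /= conjCK mulrAC x33 mul1r.
Qed.

End Converse.

End Mobius.

Theorem theorem7p1 (R : realType) (x1 x2 x3 : C R) :
  let x : C3 R := (x1, x2, x3) in
  [<-> [/\ x1 = x2^* * x3, `|x3| = 1 & `|x2| <= 1];
       (x1 * x2 <> x3 /\ disc_automorphism (fun z => Psi z x)) \/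
         [/\ x1 * x2 = x3, `|x1| = 1, `|x2| = 1 & `|x3| = 1];
       peak_point x;
       exists U : 'M[C R]_2, U \is unitarymx /\ x = tetra_pi U;
       exists U : 'M[C R]_2, [/\ U \is unitarymx, U^T = U & x = tetra_pi U];
       distinguished_boundary x;
       closure (@tetrablock R) x /\ `|x3| = 1].

Proof.
move=> x; have xE : unitary_points x <-> [/\ x1 = x2^* * x3, `|x3| = 1 & `|x2| <= 1] by [].
(* The implications form a cycle, each link passing through S. *)
tfae.
- move=> /xE Sx; have [e|ne] := pselect (x1 * x2 = x3); last first.
    by left; split; [exact: ne|exact: (@disc_automorphism_unitary R x Sx ne)].
  right; have [/= x1E x31 x21] := Sx.
  have x2E : `|x2| = 1.
    have /eqP : `|x1 * x2| = 1 by rewrite e.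
    by rewrite normrM x1E normrM norm_conjC x31 mulr1 -expr2 sqrp_eq1// => /eqP.
  by split=> //; rewrite x1E normrM norm_conjC x2E x31 mulr1.
- case=> [[ne aut]|[e x11 x21 x31]]; apply: unitary_points_peak.
    exact: (unitary_of_disc_automorphism ne aut).
  (* Here x2' x3 = x2' x1 x2 = x1. *)
  by split; rewrite /= ?x21// -e mulrCA [_^* * _]mulrC -normCK x21 expr1n mulr1.
- by move=> /peak_pointE/unitary_points_symmetric[U [Uu _ UE]]; exists U.
- by move=> [U [/unitary_tetra_pi + UE]]; rewrite -UE => /unitary_points_symmetric.
- move=> [U [/unitary_tetra_pi + _ UE]]; rewrite -UE; exact: (distinguished_boundaryE x).2.
- by move=> /distinguished_boundaryE/closure_norm1_unitary.
- by move=> /(closure_norm1_unitary x)/xE.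
Qed.
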